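(* Let $\nu$ be a symmetric Lévy measure on $\mathbb{R}^d$ with $\nu(\mathbb{R}^d)=\infty$. Assume that there are constants $M_0>0$ and $t_p\in(0,\infty]$ such that $$\int_{\mathbb{R}^d} e^{-t\Phi(\xi)}|\xi|\,d\xi\le M_0\,h(t)^{-d-1}\qquad\text{for all } t\in(0,t_p).$$ Let $\nu=\nu_s+\nu_c$, where $\nu_s$ and $\nu_c$ are the singular and the absolutely continuous part of $\nu$ with respect to Lebesgue measure $m$ on $\mathbb{R}^d\setminus\{0\}$, and let $\frac{d\nu_c}{dm}$ be the Radon–Nikodym derivative of $\nu_c$. Assume that there exists $r_0>0$ such that $$\inf_{0<|y|<r_0}\frac{d\nu_c}{dm}(y)>0.$$ Then there exist positive constants $c_1,c_2,c_3,c_4$ such that $$p_t(x)\ge c_1\,e^{-c_2|x|\log\left(\frac{c_3|x|}{t}\right)}$$ for all $t\in(0,t_p)$ and $x\in\mathbb{R}^d$ with $|x|\ge\max\{r_0,c_4t\}$.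
   Context: $d\in\{1,2,\dots\}$. A symmetric Lévy measure on $\mathbb{R}^d$ is a Borel measure $\nu$ with $\nu(\{0\})=0$, $\int(1\wedge|y|^2)\,\nu(dy)<\infty$ and $\nu(-D)=\nu(D)$ for all Borel $D\subset\mathbb{R}^d$. Put $\Phi(\xi)=\int_{\mathbb{R}^d}(1-\cos(\xi\cdot y))\,\nu(dy)$, $\xi\in\mathbb{R}^d$. $\{P_t\}_{t\ge0}$ is the convolution semigroup of probability measures on $\mathbb{R}^d$ with $\int e^{i\xi\cdot y}P_t(dy)=e^{-t\Phi(\xi)}$. Put $\Psi(r)=\sup_{|\xi|\le r}\Phi(\xi)$ for $r>0$; since $\nu(\mathbb{R}^d)=\infty$, $\Psi$ is continuous, nondecreasing and unbounded. Put $\Psi^{-1}(s)=\sup\{r>0:\Psi(r)=s\}$ for $s>0$ and $h(t)=1/\Psi^{-1}(1/t)$ for $t>0$. Under the integral assumption in the claim each $P_t$, $t>0$, has a continuous density $p_t$ with respect to Lebesgue measure; $p_t$ denotes this version. *)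

(* Defs.v *)
From HB Require Import structures.
From mathcomp Require Import all_boot all_order all_algebra.
From mathcomp Require Import all_classical all_reals all_analysis.
From mathcomp Require Import measurable_realfun.
From mathcomp Require Import complex.

Set Implicit Arguments.
Unset Strict Implicit.
Unset Printing Implicit Defensive.

Import Order.TTheory GRing.Theory Num.Theory.
Import numFieldNormedType.Exports.

Local Open Scope classical_set_scope.
Local Open Scope ring_scope.

Section borel_rV.
Context (R : realType) (d : nat).

Definition borel_rV : set (set 'rV[R]_d) := <<s open >>.

Let borel_rV0 : borel_rV set0.
Proof. exact: sigma_algebra0. Qed.

Let borel_rVC A : borel_rV A -> borel_rV (~` A).
Proof. exact: sigma_algebraC. Qed.

Let borel_rV_bigcup (F : (set 'rV[R]_d)^nat) :
  (forall i, borel_rV (F i)) -> borel_rV (\bigcup_i F i).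
Proof. exact: sigma_algebra_bigcup. Qed.

HB.instance Definition _ :=
  @isMeasurable.Build (sigma_display (@open 'rV[R]_d)) 'rV[R]_d
    borel_rV borel_rV0 borel_rVC borel_rV_bigcup.

End borel_rV.

Section measurable_rV.
Context (R : realType).

Lemma open_measurable_rV d (U : set 'rV[R]_d) : open U -> measurable U.
Proof. exact: sub_sigma_algebra. Qed.

Lemma measurable_coord_rV d (i : 'I_d) :
  measurable_fun setT (fun v : 'rV[R]_d => v 0 i : measurableTypeR R).
Proof.
apply: (measurability R.-ocitv.-measurable) => // _ [_ [[a b] _ <-] <-].
have mgt c : measurable [set v : 'rV[R]_d | c < v 0 i].
  apply: open_measurable_rV.
  apply: (@open_comp _ _ (fun v : 'rV[R]_d => v 0 i) [set x | c < x]).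
    by move=> v _; exact: coord_continuous.
  exact: open_gt.
suff -> : [set: 'rV[R]_d] `&`
      (fun v => v 0 i : measurableTypeR R) @^-1` `]a, b] =
    [set v : 'rV[R]_d | a < v 0 i] `\` [set v | b < v 0 i].
  by apply: measurableD; exact: mgt.
rewrite setTI; apply/seteqP; split => v /=; rewrite in_itv/= leNgt.
  by move=> /andP[? /negP].
by move=> [? /negP ?]; apply/andP.
Qed.

Let box d (q : 'rV[rat]_d * nat) : set 'rV[R]_d :=
  [set x | forall i, `|x 0 i - ratr (q.1 0 i)| < q.2.+1%:R^-1].

Let open_bigcup_box d (U : set 'rV[R]_d) : open U ->
  U = \bigcup_(q in [set q | box q `<=` U]) box q.
Proof.
move=> oU; apply/seteqP; split => [x Ux|x [q /= + xq]]; last exact.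
have /nbhs_ballP[e /= e0 xeU] : nbhs x U by exact: open_nbhs_nbhs.
have [k ke] : exists k : nat, k.+1%:R^-1 < e / 2 :> R.
  have [n _ ne] := near_infty_natSinv_lt (PosNum (divr_gt0 e0 (ltr0Sn R 1))).
  by exists n; exact: (ne n (leqnn n)).
have q_ (i : 'I_d) : {q : rat | `|x 0 i - ratr q| < k.+1%:R^-1}.
  apply: cid; have k0 : 0 < k.+1%:R^-1 :> R by rewrite invr_gt0.
  have /rat_in_itvoo[q] : x 0 i - k.+1%:R^-1 < x 0 i + k.+1%:R^-1.
    by rewrite ltrBlDr -addrA ltrDl addr_gt0.
  by rewrite in_itv/= => qi; exists q; rewrite distrC ltr_distl.
exists (\row_i sval (q_ i), k) => /=; last first.
  by move=> i /=; rewrite mxE; exact: svalP (q_ i).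
move=> y /= yq; apply: xeU; split => // i j; rewrite ord1 /ball/=.
have := yq j; rewrite mxE => yj.
rewrite (le_lt_trans (ler_distD (ratr (sval (q_ j))) _ _))// (splitr e) ltrD//.
  by apply: lt_trans ke; exact: svalP (q_ j).
by apply: lt_trans ke; rewrite distrC.
Qed.

Lemma measurable_fun_rV dT (T : measurableType dT) d (f : T -> 'rV[R]_d) :
  (forall i, measurable_fun setT (fun x => f x 0 i : measurableTypeR R)) ->
  measurable_fun setT f.
Proof.
move=> mf; apply: (measurability (@open 'rV[R]_d)) => //.
move=> _ [U oU <-]; rewrite setTI (open_bigcup_box oU) preimage_bigcup.
rewrite bigcup_mkcond; apply: countable_bigcupT_measurable => // q.
case: ifPn => // _.
suff -> : f @^-1` box q = \bigcap_(i in [set: 'I_d])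
    ((fun x => f x 0 i) @^-1` ball (ratr (q.1 0 i) : R) (q.2.+1%:R^-1)).
  apply: fin_bigcap_measurable => // i _; rewrite -[X in measurable X]setTI.
  by apply: mf => //; exact: measurable_ball.
by apply/seteqP; split => x xq i => [_|]; rewrite /ball/= distrC; exact: xq.
Qed.

End measurable_rV.

(* Lebesgue measure on R^d, by recursion on d: the image of the product of
   one-dimensional Lebesgue measure and Lebesgue measure on R^d under
   (x, v) |-> (x, v_1, ..., v_d).  On R^0 it is the unit mass.  Its value on
   boxes is computed in lebesgue_rV_box below. *)
Section lebesgue_rV.
Context (R : realType).

Definition cons_rV d (p : measurableTypeR R * 'rV[R]_d) : 'rV[R]_d.+1 :=
  row_mx (p.1 : R)%:M p.2 : 'rV[R]_(1 + d).

Definition uncons_rV d (v : 'rV[R]_d.+1) : measurableTypeR R * 'rV[R]_d :=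
  (v 0 0, rsubmx (v : 'rV[R]_(1 + d))).

Lemma cons_rV0 d p : @cons_rV d p 0 0 = p.1.
Proof.
have -> : (0 : 'I_d.+1) = lshift d (0 : 'I_1) by exact: val_inj.
by rewrite /cons_rV; apply: etrans (row_mxEl _ _ _ _) _; rewrite mxE eqxx.
Qed.

Lemma cons_rVS d p i : @cons_rV d p 0 (lift 0 i) = p.2 0 i.
Proof.
have -> : lift 0 i = rshift 1 i by exact: val_inj.
by rewrite /cons_rV; exact: row_mxEr.
Qed.

Lemma uncons_rVK d : cancel (@cons_rV d) (@uncons_rV d).
Proof.
by move=> [x v]; rewrite /uncons_rV cons_rV0 /cons_rV row_mxKr.
Qed.

Lemma measurable_cons_rV d : measurable_fun setT (@cons_rV d).
Proof.
apply: measurable_fun_rV => i; have [j ->|->] := unliftP 0 i.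
  under eq_fun do rewrite cons_rVS.
  exact: measurableT_comp (measurable_coord_rV j) measurable_snd.
by under eq_fun do rewrite cons_rV0; exact: measurable_fst.
Qed.

Lemma measurable_uncons_rV d : measurable_fun setT (@uncons_rV d).
Proof.
apply: measurable_fun_pair; first exact: measurable_coord_rV.
apply: measurable_fun_rV => i.
by under eq_fun do rewrite mxE; exact: measurable_coord_rV.
Qed.

Section step.
Context d (m : {sigma_finite_measure set 'rV[R]_d -> \bar R}).

Definition lebesgue_rV_step : set 'rV[R]_d.+1 -> \bar R :=
  pushforward (@lebesgue_measure R \x m)%E (@cons_rV d).

Let step0 : lebesgue_rV_step set0 = 0%E.
Proof. by rewrite /lebesgue_rV_step /pushforward preimage_set0 measure0. Qed.

Let mpreimage A : measurable A -> measurable (@cons_rV d @^-1` A).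
Proof.
by move=> mA; rewrite -[X in measurable X]setTI; exact: measurable_cons_rV.
Qed.

Let step_ge0 A : (0 <= lebesgue_rV_step A)%E.
Proof. by apply: integral_ge0 => x _; exact: measure_ge0. Qed.

Let step_sigma_additive : semi_sigma_additive lebesgue_rV_step.
Proof.
move=> F mF tF mUF; rewrite /lebesgue_rV_step /pushforward preimage_bigcup.
apply: measure_semi_sigma_additive.
- by move=> n; exact: mpreimage.
- apply/trivIsetP => i j _ _ ij; rewrite -preimage_setI.
  by move/trivIsetP : tF => /(_ i j) ->//; rewrite preimage_set0.
- by rewrite -preimage_bigcup; exact: mpreimage.
Qed.

HB.instance Definition _ := isMeasure.Build _ _ _ lebesgue_rV_step
  step0 step_ge0 step_sigma_additive.

Let sigma_finite_step : sigma_finite setT lebesgue_rV_step.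
Proof.
have /sigma_finiteP[F [FT ndF Foo]] := sigma_finiteT (@lebesgue_measure R).
have /sigma_finiteP[G [GT ndG Goo]] := sigma_finiteT m.
exists (fun k => @uncons_rV d @^-1` (F k `*` G k)).
  rewrite -preimage_bigcup; apply/seteqP; split => // v _ /=.
  have [i _ Fi] : (\bigcup_i F i) (uncons_rV v).1 by rewrite -FT.
  have [j _ Gj] : (\bigcup_i G i) (uncons_rV v).2 by rewrite -GT.
  exists (maxn i j) => //; split.
    by move: Fi; exact/subsetPset/ndF/leq_maxl.
  by move: Gj; exact/subsetPset/ndG/leq_maxr.
move=> k; have [mF Fk] := Foo k; have [mG Gk] := Goo k; split.
  rewrite -[X in measurable X]setTI; apply: measurable_uncons_rV => //.
  exact: measurableX.
rewrite /lebesgue_rV_step /pushforward -comp_preimage.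
rewrite (_ : _ \o _ = id) ?preimage_id; last first.
  by apply/funext => p /=; rewrite uncons_rVK.
by rewrite product_measure1E// lte_mul_pinfty// ge0_fin_numE.
Qed.

HB.instance Definition _ :=
  Measure_isSigmaFinite.Build _ _ _ lebesgue_rV_step sigma_finite_step.

End step.

Fixpoint lebesgue_rV d : {sigma_finite_measure set 'rV[R]_d -> \bar R} :=
  match d with
  | 0%N => \d_(0 : 'rV[R]_0)
  | d'.+1 => lebesgue_rV_step (lebesgue_rV d')
  end.

Lemma lebesgue_rV_box d (a b : 'rV[R]_d) : (forall i, a 0 i <= b 0 i) ->
  lebesgue_rV d [set x | forall i, x 0 i \in `]a 0 i, b 0 i]] =
  (\prod_(i < d) (b 0 i - a 0 i))%:E.
Proof.
elim: d a b => [|d IH] a b ab.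
  by rewrite big_ord0 /= /dirac indicE mem_set// => -[].
rewrite big_ord_recl /= /lebesgue_rV_step /pushforward.
pose tl (v : 'rV[R]_d.+1) : 'rV[R]_d := \row_i v 0 (lift 0 i).
have -> : @cons_rV d @^-1` [set x | forall i, x 0 i \in `]a 0 i, b 0 i]] =
    ([set` `]a 0 0, b 0 0]] : set (measurableTypeR R)) `*`
    [set x : 'rV[R]_d | forall i, x 0 i \in `]tl a 0 i, tl b 0 i]].
  apply/seteqP; split => -[x v] /= xv.
    split; first by have := xv 0; rewrite cons_rV0.
    by move=> i; have := xv (lift 0 i); rewrite cons_rVS !mxE.
  move=> i; have [j ->|->] := unliftP 0 i; last by rewrite cons_rV0; case: xv.
  by rewrite cons_rVS; case: xv => _ /(_ j); rewrite !mxE.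
rewrite product_measure1E//; last first.
  rewrite [X in measurable X](_ : _ = \bigcap_(i in [set: 'I_d])
     ((fun x : 'rV[R]_d => x 0 i : measurableTypeR R) @^-1`
       `]tl a 0 i, tl b 0 i])).
    apply: fin_bigcap_measurable => // i _; rewrite -[X in measurable X]setTI.
    exact: measurable_coord_rV.
  by apply/seteqP; split => x xi i => [_|]; exact: xi.
rewrite IH; last by move=> i; rewrite !mxE; exact: ab.
rewrite EFinM; congr (_ * _)%E.
  apply: etrans (lebesgue_measure_itv `]a 0 0, b 0 0]) _ => /=.
  rewrite lte_fin; case: ltP => // ba; congr EFin; apply/esym/eqP.
  by rewrite subr_eq0 eq_le ba ab.
by congr EFin; apply: eq_bigr => i _; rewrite !mxE.
Qed.

End lebesgue_rV.

Section euclidean.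
Context (R : realType) (d : nat).

Definition dotp (x y : 'rV[R]_d) : R := \sum_(i < d) x 0 i * y 0 i.

(* The norm `|x| of the library on 'rV[R]_d is the maximum norm. *)
Definition enorm (x : 'rV[R]_d) : R := Num.sqrt (dotp x x).

End euclidean.

Section levy.
Context (R : realType) (d : nat).
Implicit Types nu : {measure set 'rV[R]_d -> \bar R}.

Definition symmetric_levy_measure nu : Prop :=
  [/\ nu [set 0 : 'rV[R]_d] = 0%E,
      (\int[nu]_y (Num.min 1 (enorm y ^+ 2))%:E < +oo)%E &
      forall D : set 'rV[R]_d, measurable D -> nu [set - y | y in D] = nu D].

Definition Phi nu (xi : 'rV[R]_d) : R := \int[nu]_y (1 - cos (dotp xi y)).

Definition Psi nu (r : R) : R :=
  sup [set Phi nu xi | xi in [set xi | enorm xi <= r]].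

Definition Psi_inv nu (s : R) : R := sup [set r | 0 < r /\ Psi nu r = s].

Definition h nu (t : R) : R := 1 / Psi_inv nu (1 / t).

(* The integral of exp(i xi.y), real and imaginary parts separately. *)
Definition charfun nu (xi : 'rV[R]_d) : R[i] :=
  ((\int[nu]_y cos (dotp xi y))%R +i* (\int[nu]_y sin (dotp xi y))%R)%C.

Definition convolution (mu1 mu2 : {measure set 'rV[R]_d -> \bar R})
    (A : set 'rV[R]_d) : \bar R :=
  (\int[mu1]_x mu2 [set y : 'rV[R]_d | A (x + y)%R])%E.

(* Only the values P t with 0 <= t matter. *)
Definition convolution_semigroup (P : R -> probability 'rV[R]_d R) : Prop :=
  [/\ forall A : set 'rV[R]_d, measurable A -> P 0 A = \d_(0 : 'rV[R]_d) A,
      forall (s t : R) (A : set 'rV[R]_d), 0 <= s -> 0 <= t -> measurable A ->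
        P (s + t) A = convolution (P s) (P t) A &
      forall f : 'rV[R]_d -> R, continuous f ->
        (exists M : R, forall x, `|f x| <= M) ->
        (fun t => \int[P t]_x f x) @ 0^'+ --> f 0].

Definition levy_semigroup nu (P : R -> probability 'rV[R]_d R) : Prop :=
  convolution_semigroup P /\
  forall (t : R) xi, 0 <= t -> charfun (P t) xi = (expR (- t * Phi nu xi))%:C%C.

Definition continuous_density nu (p : 'rV[R]_d -> R) : Prop :=
  [/\ continuous p, forall x, 0 <= p x &
      forall A : set 'rV[R]_d, measurable A ->
        nu A = (\int[lebesgue_rV R d]_(x in A) (p x)%:E)%E].

Definition mutually_singular
    (mu1 mu2 : {measure set 'rV[R]_d -> \bar R}) : Prop :=
  exists2 N, measurable N & mu1 (~` N) = 0%E /\ mu2 N = 0%E.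

Definition lebesgue_decomposition nu
    (nu_s nu_c : {measure set 'rV[R]_d -> \bar R}) : Prop :=
  [/\ forall A : set 'rV[R]_d, measurable A -> nu A = (nu_s A + nu_c A)%E,
      mutually_singular nu_s (lebesgue_rV R d) &
      nu_c `<< lebesgue_rV R d].

(* The Radon-Nikodym derivative of the library is restricted to finite measures
   nu, whereas the measures considered here are only sigma-finite. *)
Definition radon_nikodym_derivative nu (f : 'rV[R]_d -> \bar R) : Prop :=
  [/\ measurable_fun setT f, forall x, (0 <= f x)%E &
      forall A : set 'rV[R]_d, measurable A ->
        nu A = (\int[lebesgue_rV R d]_(x in A) f x)%E].

End levy.

(* Main.v *)
(* Near the origin nu dominates a multiple of Lebesgue measure, so jumps of
   moderate size have a rate that is bounded below. Put
   w(x) = (1 - cos(eta.x))/2, split P_u = (1-w) P_u + w P_u into small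
   displacements and jumps, and expand P_s as the n-th convolution power of P_u,
   u = s/n. Keeping the terms with exactly one jump gives
     P_s >= n (w P_u) * Q,  Q the (n-1)-th convolution power of (1-w) P_u.
   By the expansion of the characteristic function exp(-u Phi), w P_u / u tends
   to w nu against trigonometric polynomials, uniformly in translations, while
   for small s the factor Q keeps mass at least 1/2 near the origin.
   Hence p_s >= c s near two opposite points v and -v, so p_(2s) >= c s^2 near
   the origin. Reaching x with n of order |x| steps of duration t/n yields
   p_t(x) >= c1 (c t / |x|)^(C |x|). *)

Require Import Defs.
From HB Require Import structures.
From mathcomp Require Import all_boot all_order all_algebra.
From mathcomp Require Import all_classical all_reals all_analysis.
From mathcomp Require Import ring lra measurable_realfun.

Set Implicit Arguments.
Unset Strict Implicit.
Unset Printing Implicit Defensive.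

Import Order.TTheory GRing.Theory Num.Theory.
Import numFieldNormedType.Exports.

Local Open Scope classical_set_scope.
Local Open Scope ring_scope.

(** What is known of P_u is its characteristic function, so the jump estimate is run on cosines. The
    weight 1 - cos(eta.x) does three things. It is integrable against the infinite measure nu. Times
    a cosine it is a second difference of characters, so the zeroth-order terms of exp(-u Phi)
    cancel and the nu-integral remains as the term of order u. And it is at least 1 near v and -v
    once eta is adapted to v. A jump in one of n increments is known up to O(u^2), hence up to
    O(s^2/n) in total; with s fixed and n growing the error disappears. The obstacle is the return
    to densities: trigonometric polynomials do not decay at infinity, so bounds against them are
    localised by high powers of cosines with a very long period. Two opposite jumps are combined
    because one jump controls the density only away from 0, while chaining in an arbitrary direction
    needs a ball about 0. *)

Local Notation pushforward_measure :=
  measure_function_pushforward__canonical__measure_function_Measure.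

(** * Lebesgue measure on R^d *)

Lemma measurable_fun_continuous (R : realType) (d : nat) (f : 'rV[R]_d -> R) :
  continuous f -> measurable_fun setT f.
Proof.
move=> /continuousP cf; apply: (measurability _ (RGenOpens.measurableE R)).
move=> _ [_ [a [b ->] <-]]; rewrite setTI; apply: open_measurable_rV.
exact/cf/interval_open.
Qed.

Lemma measurable_fun_bigsum d (T : measurableType d) (R : realType) (I : Type)
    (s : seq I) (F : I -> T -> R) :
  (forall i, measurable_fun setT (F i)) ->
  measurable_fun setT (fun x => \sum_(i <- s) F i x).
Proof.
move=> mF; elim: s => [|i s IH].
  by under eq_fun do rewrite big_nil; exact: measurable_cst.
by under eq_fun do rewrite big_cons; exact: measurable_funD.
Qed.

Section vector_measurability.
Context (R : realType) (d : nat).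
Local Notation V := 'rV[R]_d.

Lemma measurable_dotp (xi : V) :
  measurable_fun setT (dotp xi).
Proof.
apply: (@measurable_fun_bigsum _ V R _ _ (fun i y => xi 0 i * y 0 i)) => i.
by apply: measurable_funM; [exact: measurable_cst|exact: measurable_coord_rV].
Qed.

Lemma measurable_enorm : measurable_fun setT (@enorm R d).
Proof.
apply: (@measurableT_comp _ _ _ _ _ _ (@Num.sqrt R)).
  by apply: continuous_measurable_fun; exact: sqrt_continuous.
apply: (@measurable_fun_bigsum _ V R _ _ (fun i y => y 0 i * y 0 i)) => i.
by apply: measurable_funM; exact: measurable_coord_rV.
Qed.

Lemma measurable_addV : measurable_fun setT (fun p : V * V => p.1 + p.2).
Proof.
apply: measurable_fun_rV => i; under eq_fun do rewrite mxE.
apply: measurable_funD.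
  exact: measurableT_comp (measurable_coord_rV i) measurable_fst.
exact: measurableT_comp (measurable_coord_rV i) measurable_snd.
Qed.

Lemma measurable_shiftV (z : V) : measurable_fun setT (fun x : V => z + x).
Proof.
apply: measurable_fun_rV => i; under eq_fun do rewrite mxE.
by apply: measurable_funD; [exact: measurable_cst|exact: measurable_coord_rV].
Qed.

Lemma measurable_oppV : measurable_fun setT (fun x : V => - x).
Proof.
apply: measurable_fun_rV => i; under eq_fun do rewrite mxE.
exact: measurableT_comp (measurable_coord_rV i).
Qed.

(** Half-open so that [lebesgue_rV_box] gives its volume. It lies between the open and the closed
    ball of radius r for the maximum norm, which is how it is used. *)
Definition hcube (c : V) (r : R) : set V :=
  [set x | forall i, x 0 i \in `]c 0 i - r, c 0 i + r]].

Lemma measurable_hcube c r : measurable (hcube c r).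
Proof.
rewrite [X in measurable X](_ : _ = \bigcap_(i in [set: 'I_d])
  ((fun x : V => x 0 i : measurableTypeR R) @^-1` `]c 0 i - r, c 0 i + r])).
  apply: fin_bigcap_measurable => // i _; rewrite -[X in measurable X]setTI.
  exact: measurable_coord_rV.
by apply/seteqP; split => x xi i => [_|]; exact: xi.
Qed.

Lemma lebesgue_hcube c r : 0 <= r ->
  lebesgue_rV R d (hcube c r) = ((2 * r) ^+ d)%:E.
Proof.
move=> r0; pose a : V := \row_i (c 0 i - r); pose b : V := \row_i (c 0 i + r).
rewrite (_ : hcube c r = [set x | forall i, x 0 i \in `]a 0 i, b 0 i]]).
  rewrite lebesgue_rV_box => [|i]; last by rewrite !mxE; lra.
  congr EFin; rewrite -[in RHS](card_ord d) -prodr_const.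
  by apply: eq_bigr => i _; rewrite !mxE; ring.
by apply/seteqP; split => x /= + i => /(_ i); rewrite !mxE.
Qed.

Lemma lebesgue_hcube_lty c r : 0 <= r -> (lebesgue_rV R d (hcube c r) < +oo)%E.
Proof. by move=> r0; rewrite lebesgue_hcube// ltry. Qed.

Lemma hcube_shift c z r x : hcube (z + c) r (z + x) <-> hcube c r x.
Proof.
by split => + i => /(_ i); rewrite !mxE !in_itv/= => /andP[? ?]; apply/andP; split; lra.
Qed.

Lemma hcube_norm c r x : hcube c r x -> forall i, `|x 0 i - c 0 i| <= r.
Proof.
by move=> + i => /(_ i); rewrite in_itv/= ler_distl => /andP[? ?]; apply/andP; split; lra.
Qed.

Lemma norm_hcube (c : V) r (x : V) : (forall i, `|x 0 i - c 0 i| < r) -> hcube c r x.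
Proof.
by move=> + i => /(_ i); rewrite in_itv/= ltr_distl => /andP[? ?]; apply/andP; split; lra.
Qed.

End vector_measurability.

Section translation_invariance.
Context (R : realType).

Lemma measurable_shiftR (a : R) :
  measurable_fun setT (fun x : measurableTypeR R => a + x : measurableTypeR R).
Proof. by apply: measurable_funD => //; exact: measurable_cst. Qed.

Lemma lebesgue_measure_shift (a : R) (A : set (measurableTypeR R)) : measurable A ->
  lebesgue_measure ((fun x => a + x) @^-1` A) = lebesgue_measure A.
Proof.
move=> mA.
apply/esym; rewrite -[RHS]/(pushforward lebesgue_measure (fun x => a + x) A).
apply: (@lebesgue_measure_unique _
  (pushforward_measure lebesgue_measure (measurable_shiftR a))) => //.
move=> _ [[x y] _ <-] /=; rewrite /pushforward.
rewrite (_ : _ @^-1` _ = [set` `]x - a, y - a]]); last first.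
  apply/seteqP; split => z /=; rewrite !in_itv/= => /andP[? ?];
    apply/andP; split; lra.
rewrite !lebesgue_measure_itv/= !lte_fin -!EFinB.
rewrite (_ : (x - a < y - a) = (x < y)); first by case: ifP => // _; congr EFin; ring.
by apply/idP/idP; lra.
Qed.

(** Under [cons_rV] a shift acts separately on the two factors, so uniqueness of the product measure
    reduces the claim to dimension one and the induction hypothesis. *)
Lemma lebesgue_rV_shift d (z : 'rV[R]_d) A : measurable A ->
  lebesgue_rV R d ((fun x => z + x) @^-1` A) = lebesgue_rV R d A.
Proof.
elim: d z A => [|d IH] z A mA.
  congr (_ _); apply/seteqP.
  by split => x /=; rewrite (_ : z + x = x)//; apply/matrixP => i [].
rewrite /= /lebesgue_rV_step /pushforward.
pose p := uncons_rV z.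
pose sh (q : measurableTypeR R * 'rV[R]_d) : measurableTypeR R * 'rV[R]_d := (p.1 + q.1, p.2 + q.2).
have msh : measurable_fun setT sh.
  apply: measurable_fun_pair.
    by apply: measurable_funD; [exact: measurable_cst|exact: measurable_fst].
  exact: measurableT_comp (measurable_shiftV p.2) measurable_snd.
have mB : measurable (@cons_rV R d @^-1` A).
  by rewrite -[X in measurable X]setTI; exact: measurable_cons_rV.
have shE q : z + cons_rV q = cons_rV (sh q).
  apply/rowP => i; rewrite [LHS]mxE; have [j ->|->] := unliftP 0 i.
    rewrite !cons_rVS /= !mxE; congr (z _ _ + _); exact: val_inj.
  by rewrite !cons_rV0.
rewrite (_ : _ @^-1` _ = sh @^-1` (@cons_rV R d @^-1` A)); last first.
  by apply/seteqP; split => q /=; rewrite shE.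
apply/esym; apply: (@product_measure_unique _ _ _ _ _ _ _
  (pushforward_measure (lebesgue_measure \x lebesgue_rV R d)%E msh)) => //.
move=> B C mmB mC /=; rewrite /pushforward.
rewrite (_ : _ @^-1` _ = ((fun x => p.1 + x) @^-1` B) `*` ((fun x => p.2 + x) @^-1` C))//.
rewrite product_measure1E.
- by congr (_ * _)%E; [exact: lebesgue_measure_shift|exact: IH].
- by rewrite -[X in measurable X]setTI; exact: measurable_shiftR.
- by rewrite -[X in measurable X]setTI; exact: measurable_shiftV.
Qed.

Lemma ge0_integral_lebesgue_rV_shift d (z : 'rV[R]_d) (F : 'rV[R]_d -> \bar R) :
  measurable_fun setT F -> (forall x, 0 <= F x)%E ->
  (\int[lebesgue_rV R d]_x F (z + x)%R = \int[lebesgue_rV R d]_x F x)%E.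
Proof.
move=> mF F0.
rewrite -[LHS](ge0_integral_pushforward (measurable_shiftV z) (lebesgue_rV R d) measurableT mF)//.
apply: (@eq_measure_integral _ _ _ _ (lebesgue_rV R d)
  (pushforward_measure (lebesgue_rV R d) (measurable_shiftV z))).
by move=> A mA _; exact: lebesgue_rV_shift.
Qed.

End translation_invariance.

(** * Convolution powers and the one-jump bound *)

Section weighted_shift.
Context (R : realType) (d : nat) (mu : probability 'rV[R]_d R).
Local Notation V := 'rV[R]_d.
Local Open Scope ereal_scope.
Implicit Types (k : V -> R) (g : V -> \bar R).

(** The averaging operator of the measure k mu. Its iterates play the part of convolution powers,
    which therefore never have to be built as measures. *)
Definition wshift k g (z : V) : \bar R := \int[mu]_x ((k x)%:E * g (z + x)%R).

Lemma integral_one : \int[mu]_x (cst 1%R x)%:E = 1.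
Proof.
by rewrite -[RHS](probability_setT mu) -[RHS]mul1e -integral_cst.
Qed.

Section nonneg.
Variable k : V -> R.
Hypotheses (mk : measurable_fun setT k) (k0 : forall x, (0 <= k x)%R).

Lemma wshift_ge0 g : (forall x, 0 <= g x) -> forall z, 0 <= wshift k g z.
Proof. by move=> g0 z; apply: integral_ge0 => x _; rewrite mule_ge0// lee_fin. Qed.

Let mkE : measurable_fun setT (EFin \o k).
Proof. exact/measurable_EFinP. Qed.

Lemma measurable_wshift_arg g z : measurable_fun setT g ->
  measurable_fun setT (fun x => (k x)%:E * g (z + x)%R).
Proof.
move=> mg; apply: emeasurable_funM => //.
exact: measurableT_comp mg (measurable_shiftV z).
Qed.

Lemma measurable_wshift g : measurable_fun setT g -> (forall x, 0 <= g x) ->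
  measurable_fun setT (wshift k g).
Proof.
move=> mg g0.
apply: (@measurable_fun_fubini_tonelli_F _ _ _ _ _ mu
  (fun p : V * V => (k p.2)%:E * g (p.1 + p.2)%R)).
- apply: emeasurable_funM; first exact: measurableT_comp mkE measurable_snd.
  exact: measurableT_comp mg (@measurable_addV R d).
- by move=> p; rewrite mule_ge0// lee_fin.
Qed.

Lemma le_wshift g1 g2 : measurable_fun setT g1 -> measurable_fun setT g2 ->
  (forall x, 0 <= g1 x) -> (forall x, g1 x <= g2 x) ->
  forall z, wshift k g1 z <= wshift k g2 z.
Proof.
move=> mg1 mg2 g10 g12 z; apply: ge0_le_integral => //.
- by move=> x _; rewrite mule_ge0// lee_fin.
- exact: measurable_wshift_arg.
- exact: measurable_wshift_arg.
- by move=> x _; rewrite lee_pmul// lee_fin.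
Qed.

Lemma wshiftZ (c : R) g : measurable_fun setT g -> (forall x, 0 <= g x) ->
  (0 <= c)%R -> forall z, wshift k (fun x => c%:E * g x) z = c%:E * wshift k g z.
Proof.
move=> mg g0 c0 z; rewrite -ge0_integralZl//.
- by apply: eq_integral => x _; rewrite muleCA.
- exact: measurable_wshift_arg.
- by move=> x _; rewrite mule_ge0// lee_fin.
Qed.

Lemma wshiftDcst (c : R) g : measurable_fun setT g -> (forall x, 0 <= g x) ->
  (0 <= c)%R -> forall z,
  wshift k (fun x => g x + c%:E) z = wshift k g z + c%:E * \int[mu]_x (k x)%:E.
Proof.
move=> mg g0 c0 z; rewrite -ge0_integralZl//; last first.
  by move=> x _; rewrite lee_fin.
rewrite -ge0_integralD//.
- by apply: eq_integral => x _; rewrite ge0_muleDr ?lee_fin// (muleC c%:E).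
- by move=> x _; rewrite mule_ge0// lee_fin.
- exact: measurable_wshift_arg.
- by move=> x _; rewrite mule_ge0// lee_fin.
- exact: emeasurable_funM.
Qed.

Lemma wshift_le_mass g : measurable_fun setT g -> (forall x, 0 <= g x <= 1) ->
  forall z, wshift k g z <= \int[mu]_x (k x)%:E.
Proof.
move=> mg g01 z; apply: ge0_le_integral => //.
- by move=> x _; rewrite mule_ge0 ?lee_fin//; case/andP: (g01 (z + x)%R).
- exact: measurable_wshift_arg.
- by move=> x _; rewrite -[leRHS]mule1 lee_pmul ?lee_fin//; case/andP: (g01 (z + x)%R).
Qed.

End nonneg.

Lemma wshiftDl k1 k2 g : measurable_fun setT k1 -> measurable_fun setT k2 ->
  (forall x, 0 <= k1 x)%R -> (forall x, 0 <= k2 x)%R ->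
  measurable_fun setT g -> (forall x, 0 <= g x) ->
  forall z, wshift (k1 \+ k2)%R g z = wshift k1 g z + wshift k2 g z.
Proof.
move=> mk1 mk2 k10 k20 mg g0 z; rewrite -ge0_integralD//.
- by apply: eq_integral => x _; rewrite EFinD ge0_muleDl// lee_fin.
- by move=> x _; rewrite mule_ge0// lee_fin.
- exact: measurable_wshift_arg.
- by move=> x _; rewrite mule_ge0// lee_fin.
- exact: measurable_wshift_arg.
Qed.

(** Both sides are the double integral of [F], by Tonelli. This is what makes the position of the
    jump among the increments irrelevant. *)
Lemma wshiftC k1 k2 g : measurable_fun setT k1 -> measurable_fun setT k2 ->
  (forall x, 0 <= k1 x)%R -> (forall x, 0 <= k2 x)%R ->
  measurable_fun setT g -> (forall x, 0 <= g x) ->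
  wshift k1 (wshift k2 g) = wshift k2 (wshift k1 g).
Proof.
move=> mk1 mk2 k10 k20 mg g0; apply/funext => z.
pose F (p : V * V) := (k1 p.1)%:E * (k2 p.2)%:E * g (z + p.1 + p.2)%R.
have mF : measurable_fun setT F.
  apply: emeasurable_funM.
    apply: emeasurable_funM.
      by apply/measurable_EFinP; exact: measurableT_comp mk1 measurable_fst.
    by apply/measurable_EFinP; exact: measurableT_comp mk2 measurable_snd.
  apply: (measurableT_comp mg).
  apply: (@measurableT_comp _ _ _ _ _ _ (fun p : V * V => p.1 + p.2)%R _
    (fun p : V * V => ((z + p.1)%R, p.2))); first exact: measurable_addV.
  apply: measurable_fun_pair => //.
  exact: measurableT_comp (measurable_shiftV z) measurable_fst.
have F0 p : 0 <= F p by rewrite /F !mule_ge0// lee_fin.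
transitivity (\int[mu]_x \int[mu]_y F (x, y)).
  apply: eq_integral => x _; rewrite /wshift -ge0_integralZl//.
  - by apply: eq_integral => y _; rewrite /F/= muleA.
  - exact: measurable_wshift_arg.
  - by move=> y _; rewrite mule_ge0// lee_fin.
  - by rewrite lee_fin.
rewrite fubini_tonelli//; apply: eq_integral => y _; rewrite /wshift -ge0_integralZl//.
- by apply: eq_integral => x _; rewrite /F/= muleA (muleC (k1 x)%:E) addrAC.
- exact: measurable_wshift_arg.
- by move=> x _; rewrite mule_ge0// lee_fin.
- by rewrite lee_fin.
Qed.

Section jump_decomposition.
Variable w : V -> R.
Hypotheses (mw : measurable_fun setT w) (w01 : forall x, (0 <= w x <= 1)%R).

Let w0 x : (0 <= w x)%R. Proof. by case/andP: (w01 x). Qed.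
Let v x := (1 - w x)%R.
Let v0 x : (0 <= v x)%R.
Proof. by rewrite subr_ge0; case/andP: (w01 x). Qed.
Let mv : measurable_fun setT v.
Proof. by apply: measurable_funB => //; exact: measurable_cst. Qed.

(** [T] averages over a full increment, [A] over its small part and [B] over its jump part, so T = A
    + B. *)
Let T := wshift (cst 1%R).
Let A := wshift v.
Let B := wshift w.

Let m1 : measurable_fun setT (cst 1%R : V -> R). Proof. exact: measurable_cst. Qed.
Let one0 (x : V) : (0 <= (cst 1 : V -> R) x)%R. Proof. by []. Qed.

Lemma wshift_split g : measurable_fun setT g -> (forall x, 0 <= g x) ->
  forall z, wshift (cst 1%R) g z = wshift (fun x => 1 - w x)%R g z + wshift w g z.
Proof.
move=> mg g0 z; rewrite -(wshiftDl mv mw v0 w0 mg g0).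
by congr wshift; apply/funext => x /=; rewrite /v subrK.
Qed.

Let TE g : measurable_fun setT g -> (forall x, 0 <= g x) ->
  forall z, T g z = A g z + B g z.
Proof. exact: wshift_split. Qed.

Lemma iter_wshift_ge0 k n g : (forall x, 0 <= k x)%R -> (forall x, 0 <= g x) ->
  forall z, 0 <= iter n (wshift k) g z.
Proof. by move=> k0 g0; elim: n => //= n IH z; exact: wshift_ge0. Qed.

Lemma measurable_iter_wshift k n g : measurable_fun setT k -> (forall x, 0 <= k x)%R ->
  measurable_fun setT g -> (forall x, 0 <= g x) ->
  measurable_fun setT (iter n (wshift k) g).
Proof.
move=> mk k0 mg g0; elim: n => //= n IH; apply: measurable_wshift => //.
exact: iter_wshift_ge0.
Qed.

Lemma le_iter_wshift k n g1 g2 : measurable_fun setT k -> (forall x, 0 <= k x)%R ->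
  measurable_fun setT g1 -> measurable_fun setT g2 ->
  (forall x, 0 <= g1 x) -> (forall x, g1 x <= g2 x) ->
  forall z, iter n (wshift k) g1 z <= iter n (wshift k) g2 z.
Proof.
move=> mk k0 mg1 mg2 g10 g12; have g20 x := le_trans (g10 x) (g12 x).
elim: n => //= n IH z; apply: le_wshift => //.
- exact: measurable_iter_wshift.
- exact: measurable_iter_wshift.
- exact: iter_wshift_ge0.
Qed.

Lemma iter_wshiftZ k n (c : R) g : measurable_fun setT k -> (forall x, 0 <= k x)%R ->
  measurable_fun setT g -> (forall x, 0 <= g x) -> (0 <= c)%R ->
  iter n (wshift k) (fun x => c%:E * g x) = (fun z => c%:E * iter n (wshift k) g z).
Proof.
move=> mk k0 mg g0 c0; elim: n => //= n ->; apply/funext => z.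
apply: wshiftZ => //; first exact: measurable_iter_wshift.
exact: iter_wshift_ge0.
Qed.

Lemma iter_wshift_comm n g : measurable_fun setT g -> (forall x, 0 <= g x) ->
  B (iter n A g) = iter n A (B g).
Proof.
move=> mg g0; elim: n => //= n <-; apply: wshiftC => //.
  exact: measurable_iter_wshift.
exact: iter_wshift_ge0.
Qed.

Lemma iter_wshift_no_jump n g : measurable_fun setT g -> (forall x, 0 <= g x) ->
  forall z, iter n A g z <= iter n T g z.
Proof.
move=> mg g0; elim: n => [|n IH] z; first exact: lexx.
rewrite !iterS.
have mA := measurable_iter_wshift n mv v0 mg g0.
have A0 := iter_wshift_ge0 n v0 g0.
have mT := measurable_iter_wshift n m1 one0 mg g0.
apply: (@le_trans _ _ (T (iter n A g) z)); last exact: le_wshift.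
by rewrite TE// leeDl// wshift_ge0.
Qed.

(* Keep only the outcomes where exactly one of the n+1 increments is a jump;
   all its positions contribute equally because the two parts commute. *)
Lemma iter_wshift_one_jump n g : measurable_fun setT g -> (forall x, 0 <= g x) ->
  forall z, n.+1%:R%:E * iter n A (B g) z <= iter n.+1 T g z.
Proof.
move=> mg g0; have mBg := measurable_wshift mw w0 mg g0.
have Bg0 := wshift_ge0 w0 g0.
elim: n => [|n IH] z.
  by rewrite mul1e /= TE// leeDr// wshift_ge0.
have mABg := measurable_iter_wshift n mv v0 mBg Bg0.
have ABg0 := iter_wshift_ge0 n v0 Bg0.
have mT := measurable_iter_wshift n.+1 m1 one0 mg g0.
have T0 := iter_wshift_ge0 n.+1 one0 g0.
(* Split the outermost increment. If it is small, the induction hypothesis gives n+1 copies; if it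
   is the jump, commuting [B] outwards and dropping later jumps gives one more. *)
rewrite [iter n.+2 T g]iterS TE// [iter n.+1 A _]iterS -(natr1 n.+1) EFinD.
rewrite ge0_muleDl// mul1e leeD//.
  rewrite -[X in X <= _]wshiftZ//; apply: le_wshift => //.
    by apply: emeasurable_funM => //; exact: measurable_cst.
  by move=> x; rewrite mule_ge0.
rewrite -[A _]/(iter n.+1 A (B g)) -(iter_wshift_comm n.+1 mg g0).
apply: (le_wshift mw w0 _ mT).
- exact: measurable_iter_wshift.
- exact: iter_wshift_ge0.
- exact: iter_wshift_no_jump.
Qed.

Lemma iter_wshift_le1 n g : measurable_fun setT g -> (forall x, 0 <= g x <= 1) ->
  forall z, iter n A g z <= 1.
Proof.
move=> mg g01; have g0 x : 0 <= g x by case/andP: (g01 x).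
elim: n => [|n IH] z; first by case/andP: (g01 z).
have mA := measurable_iter_wshift n mv v0 mg g0.
have A0 := iter_wshift_ge0 n v0 g0.
apply: (@le_trans _ _ (T (iter n A g) z)).
  by rewrite TE// leeDl// wshift_ge0.
apply: le_trans (wshift_le_mass m1 one0 mA _ z) _ => [x|].
  by rewrite A0 IH.
by rewrite integral_one.
Qed.

(** A union bound: since g <= 1, allowing jumps in n increments adds at most n times the jump mass
    of one. Read backwards, it bounds the jump-free part from below. *)
Lemma iter_wshift_jump_mass n g : measurable_fun setT g -> (forall x, 0 <= g x <= 1) ->
  forall z, iter n T g z <= iter n A g z + (n%:R)%:E * \int[mu]_x (w x)%:E.
Proof.
move=> mg g01; have g0 x : 0 <= g x by case/andP: (g01 x).
have w_fin : \int[mu]_x (w x)%:E \is a fin_num.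
  rewrite ge0_fin_numE; last by apply: integral_ge0 => x _; rewrite lee_fin.
  apply: (@le_lt_trans _ _ (\int[mu]_x (cst 1%R x)%:E)); last first.
    by rewrite integral_one ltry.
  apply: ge0_le_integral => //; last by move=> x _; rewrite lee_fin; case/andP: (w01 x).
  - by move=> x _; rewrite lee_fin.
  - exact/measurable_EFinP.
  - by apply/measurable_EFinP; exact: measurable_cst.
pose b := fine (\int[mu]_x (w x)%:E).
have bE : \int[mu]_x (w x)%:E = b%:E by rewrite fineK.
have b0 : (0 <= b)%R by apply: fine_ge0; apply: integral_ge0 => x _; rewrite lee_fin.
rewrite bE; elim: n => [|n IH] z /=; first by rewrite mul0e adde0.
have mA := measurable_iter_wshift n mv v0 mg g0.
have A0 := iter_wshift_ge0 n v0 g0.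
have mT := measurable_iter_wshift n m1 one0 mg g0.
have T0 := iter_wshift_ge0 n one0 g0.
apply: (@le_trans _ _ (T (fun x => iter n A g x + (n%:R * b)%:E) z)).
  apply: le_wshift => //.
  by apply: emeasurable_funD => //; exact: measurable_cst.
rewrite [T _ z]wshiftDcst//; last by rewrite mulr_ge0.
rewrite integral_one mule1.
rewrite [wshift _ _ z]TE//.
rewrite -(natr1 n) -EFinM mulrDl mul1r -addeA leeD2l// (addrC (_ * b)%R) EFinD leeD2r//.
rewrite -bE; apply: wshift_le_mass => // x.
by rewrite A0 iter_wshift_le1.
Qed.

(** [A] has total mass at most 1, so an additive error passes through any number of small increments
    without growing. *)
Lemma iter_wshiftDcst n (c : R) g : measurable_fun setT g -> (forall x, 0 <= g x) ->
  (0 <= c)%R -> forall z, iter n A (fun x => g x + c%:E) z <= iter n A g z + c%:E.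
Proof.
move=> mg g0 c0; elim: n => [|n IH] z; first exact: lexx.
rewrite !iterS.
have mA := measurable_iter_wshift n mv v0 mg g0.
have A0 := iter_wshift_ge0 n v0 g0.
have mgc : measurable_fun setT (fun x => g x + c%:E).
  by apply: emeasurable_funD => //; exact: measurable_cst.
have gc0 x : 0 <= g x + c%:E by rewrite adde_ge0// lee_fin.
apply: (@le_trans _ _ (A (fun x => iter n A g x + c%:E) z)).
  apply: le_wshift => //.
  - exact: measurable_iter_wshift.
  - by apply: emeasurable_funD => //; exact: measurable_cst.
  - exact: iter_wshift_ge0.
rewrite /A wshiftDcst// leeD2l// -[leRHS]mule1 lee_pmul// ?lee_fin//.
  by apply: integral_ge0 => x _; rewrite lee_fin.
apply: (@le_trans _ _ (\int[mu]_x (cst 1%R x)%:E)); last by rewrite integral_one.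
apply: ge0_le_integral => //; first by move=> x _; rewrite lee_fin.
- exact/measurable_EFinP.
- by apply/measurable_EFinP; exact: measurable_cst.
- by move=> x _; rewrite lee_fin gerBl.
Qed.

End jump_decomposition.

End weighted_shift.

Section semigroup.
Context (R : realType) (d : nat) (P : R -> probability 'rV[R]_d R).
Hypothesis P_conv : convolution_semigroup P.
Local Open Scope ereal_scope.

(** The semigroup law is stated on sets. It says that P_(s+t) is the image of the product measure
    under addition, and Tonelli then gives it for functions. *)
Lemma ge0_integral_convolution (s t : R) (F : 'rV[R]_d -> \bar R) :
  (0 <= s)%R -> (0 <= t)%R -> measurable_fun setT F -> (forall x, 0 <= F x) ->
  \int[P (s + t)%R]_x F x = \int[P s]_x \int[P t]_y F (x + y)%R.
Proof.
move=> s0 t0 mF F0; have [_ PD _] := P_conv.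
pose Q := pushforward_measure
  (P s \x P t) (@measurable_addV R d).
transitivity (\int[Q]_x F x).
  apply: eq_measure_integral => A mA _; apply: etrans (PD _ _ _ s0 t0 mA) _.
  apply: eq_integral => x _ /=; congr (P t _).
  by apply/seteqP; split => y /=; rewrite /xsection/= inE.
rewrite ge0_integral_pushforward//; last exact: measurable_addV.
rewrite fubini_tonelli1//.
by apply: measurableT_comp mF (@measurable_addV R d).
by move=> p /=.
Qed.

Lemma iter_wshift_semigroup (u : R) n (g : 'rV[R]_d -> \bar R) :
  (0 <= u)%R -> measurable_fun setT g -> (forall x, 0 <= g x) ->
  forall z, iter n.+1 (wshift (P u) (cst 1%R)) g z =
    \int[P (n.+1%:R * u)%R]_x g (z + x)%R.
Proof.
move=> u0 mg g0; elim: n => [|n IH] z.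
  by rewrite mul1r /=; apply: eq_integral => x _; rewrite mul1e.
rewrite iterS -(natr1 n.+1) mulrDl mul1r addrC.
rewrite (@ge0_integral_convolution _ _ (fun x => g (z + x)%R))//.
- by apply: eq_integral => x _; rewrite mul1e IH; apply: eq_integral => y _; rewrite addrA.
- by rewrite mulr_ge0.
- exact: measurableT_comp mg (measurable_shiftV z).
Qed.

End semigroup.

(** * Trigonometric polynomials and small times *)

Section real_inequalities.
Context (R : realType).
Implicit Types a x : R.

Lemma normr_sin_le x : `|sin x| <= `|x|.
Proof.
wlog x0 : x / 0 <= x.
  move=> H; have [/H//|x0] := leP 0 x.
  by rewrite -normrN -(normrN x) -sinN H// oppr_ge0 ltW.
have [] := @MVT_segment R sin cos 0 x x0.
  by apply/continuous_subspaceT => y; exact: continuous_sin.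
move=> c _; rewrite sin0 !subr0 => ->; rewrite normrM.
by rewrite ler_piMl// cos_max.
Qed.

Lemma one_sub_cosE a : 1 - cos a = 2 * sin (a / 2) ^+ 2.
Proof.
have {1}-> : a = (a / 2) *+ 2 by rewrite -mulr_natr divfK.
by rewrite cos_mulr2n cos2sin2; ring.
Qed.

Lemma one_sub_cos_ge0 a : 0 <= 1 - cos a.
Proof. by rewrite subr_ge0 cos_le1. Qed.

Lemma one_sub_cos_le a : 1 - cos a <= a ^+ 2.
Proof.
rewrite one_sub_cosE -[sin _ ^+ 2]real_normK ?num_real//.
apply: (@le_trans _ _ (2 * `|a / 2| ^+ 2)).
  by rewrite ler_pM2l// lerXn2r ?nnegrE// normr_sin_le.
by rewrite real_normK ?num_real//; have := sqr_ge0 a; nra.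
Qed.

(** From exp a >= 1 + a and (1 + a)(1 - a + a^2) = 1 + a^3 >= 1. *)
Lemma expRN_le a : 0 <= a -> expR (- a) <= 1 - a + a ^+ 2.
Proof.
move=> a0; rewrite expRN -[leRHS]invrK lef_pV2 ?posrE ?expR_gt0//; last first.
  by rewrite invr_gt0; nra.
apply: le_trans (expR_ge1Dx a); rewrite -[leLHS]mul1r ler_pdivrMr; last by nra.
by nra.
Qed.

Lemma expRN_approx a : 0 <= a -> `|expR (- a) - 1 + a| <= a ^+ 2.
Proof.
move=> a0; have := expRN_le a0; have := expR_ge1Dx (- a) => h1 h2.
by rewrite ger0_norm; lra.
Qed.

End real_inequalities.

Section dot_product.
Context (R : realType) (d : nat).
Local Notation V := 'rV[R]_d.
Implicit Types x y z xi : V.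

Lemma dotpDl xi z x : dotp (xi + z) x = dotp xi x + dotp z x.
Proof. by rewrite /dotp -big_split; apply: eq_bigr => i _; rewrite mxE mulrDl. Qed.

Lemma dotpDr xi z x : dotp xi (z + x) = dotp xi z + dotp xi x.
Proof. by rewrite /dotp -big_split; apply: eq_bigr => i _; rewrite mxE mulrDr. Qed.

Lemma dotpNl xi x : dotp (- xi) x = - dotp xi x.
Proof. by rewrite /dotp -sumrN; apply: eq_bigr => i _; rewrite mxE mulNr. Qed.

Lemma dotpNr xi x : dotp xi (- x) = - dotp xi x.
Proof. by rewrite /dotp -sumrN; apply: eq_bigr => i _; rewrite mxE mulrN. Qed.

Lemma dotp_ge0 x : 0 <= dotp x x.
Proof. by apply: sumr_ge0 => i _; rewrite -expr2 sqr_ge0. Qed.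

Lemma enorm_ge0 x : 0 <= enorm x.
Proof. exact: sqrtr_ge0. Qed.

Lemma enorm_sqr x : enorm x ^+ 2 = dotp x x.
Proof. by rewrite sqr_sqrtr// dotp_ge0. Qed.

Lemma normr_coord_le_enorm x i : `|x 0 i| <= enorm x.
Proof.
rewrite -(ler_pXn2r (n := 2)) ?nnegrE ?enorm_ge0// enorm_sqr real_normK ?num_real//.
rewrite /dotp (bigD1 i)//= -expr2 lerDl.
by apply: sumr_ge0 => j _; rewrite -expr2 sqr_ge0.
Qed.

Lemma enorm_le_coord x a : 0 <= a -> (forall i, `|x 0 i| <= a) ->
  enorm x ^+ 2 <= d%:R * a ^+ 2.
Proof.
move=> a0 xa; rewrite enorm_sqr -[d in d%:R]card_ord -sumr_const mulr_suml.
apply: ler_sum => i _; rewrite mul1r -expr2 -[x 0 i ^+ 2]real_normK ?num_real//.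
by rewrite lerXn2r ?nnegrE.
Qed.

(** A crude form of Cauchy-Schwarz with the l1 norm of xi; it only serves integrability. *)
Lemma dotp_sqr_le xi x : dotp xi x ^+ 2 <= (\sum_i `|xi 0 i|) ^+ 2 * enorm x ^+ 2.
Proof.
rewrite -exprMn -[dotp xi x ^+ 2]real_normK ?num_real// lerXn2r ?nnegrE//.
  by rewrite mulr_ge0 ?enorm_ge0// sumr_ge0.
apply: le_trans (ler_norm_sum _ _ _) _; rewrite mulr_suml.
by apply: ler_sum => i _; rewrite normrM ler_wpM2l// normr_coord_le_enorm.
Qed.

End dot_product.

Section trigonometric_polynomials.
Context (R : realType) (d : nat).
Local Notation V := 'rV[R]_d.
Implicit Types (f g : V -> R) (xi eta : V).

(** Real trigonometric polynomials, generated so that linear statements follow by induction. The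
    phase [th] includes the sines and absorbs translations of the argument. *)
Inductive trig : (V -> R) -> Prop :=
| trig_cos xi th : trig (fun x => cos (dotp xi x + th))
| trig_add f g : trig f -> trig g -> trig (fun x => f x + g x)
| trig_scale c f : trig f -> trig (fun x => c * f x).

Lemma eq_trig f g : f =1 g -> trig f -> trig g.
Proof. by move=> /funext ->. Qed.

Lemma trig_cst c : trig (cst c).
Proof.
apply: (@eq_trig (fun x => c * cos (dotp 0 x + 0))); last exact/trig_scale/trig_cos.
move=> x /=; rewrite addr0 (_ : dotp 0 x = 0) ?cos0 ?mulr1//.
by rewrite /dotp big1// => i _; rewrite mxE mul0r.
Qed.

(** By the product-to-sum formula; it admits powers and products of cosines as test functions. *)
Lemma trig_mul f g : trig f -> trig g -> trig (fun x => f x * g x).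
Proof.
move=> tf tg; elim: tf => [xi th|f1 f2 _ tf1 _ tf2|c f1 _ tf1].
- elim: tg => [xi' th'|g1 g2 _ tg1 _ tg2|c g1 _ tg1].
  + apply: (@eq_trig (fun x => 2^-1 * cos (dotp (xi + xi') x + (th + th')) +
                              2^-1 * cos (dotp (xi - xi') x + (th - th')))); last first.
      by apply: trig_add; exact/trig_scale/trig_cos.
    move=> x; rewrite !dotpDl dotpNl (addrACA _ _ th) (addrACA _ _ th).
    rewrite -opprD; move: (dotp xi x + th) (dotp xi' x + th') => a b.
    by rewrite cosD cosB; field.
  + by apply: eq_trig (trig_add tg1 tg2) => x; rewrite mulrDr.
  + by apply: eq_trig (trig_scale c tg1) => x; rewrite mulrCA.
- by apply: eq_trig (trig_add tf1 tf2) => x; rewrite mulrDl.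
- by apply: eq_trig (trig_scale c tf1) => x; rewrite mulrA.
Qed.

Lemma trig_exp f n : trig f -> trig (fun x => f x ^+ n).
Proof.
move=> tf; elim: n => [|n IH].
  by apply: eq_trig (trig_cst 1) => x; rewrite expr0.
by apply: eq_trig (trig_mul tf IH) => x; rewrite exprS.
Qed.

Lemma trig_prod (I : Type) (s : seq I) (F : I -> V -> R) :
  (forall i, trig (F i)) -> trig (fun x => \prod_(i <- s) F i x).
Proof.
move=> tF; elim: s => [|i s IH].
  by apply: eq_trig (trig_cst 1) => x; rewrite big_nil.
by apply: eq_trig (trig_mul (tF i) IH) => x; rewrite big_cons.
Qed.

Lemma measurable_cos_dotp xi th : measurable_fun setT (fun x : V => cos (dotp xi x + th)).
Proof.
apply: (@measurableT_comp _ _ _ _ _ _ (@cos R)).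
  by apply: continuous_measurable_fun; exact: continuous_cos.
by apply: measurable_funD; [exact: measurable_dotp|exact: measurable_cst].
Qed.

Lemma measurable_trig f : trig f -> measurable_fun setT f.
Proof.
elim=> [xi th|f1 f2 _ mf1 _ mf2|c f1 _ mf1]; first exact: measurable_cos_dotp.
  exact: measurable_funD.
by apply: measurable_funM => //; exact: measurable_cst.
Qed.

Lemma trig_bounded f : trig f -> exists2 M : R, 0 <= M & forall x, `|f x| <= M.
Proof.
elim=> [xi th|f1 f2 _ [M1 M10 h1] _ [M2 M20 h2]|c f1 _ [M M0 h]].
- by exists 1 => // x; exact: cos_max.
- exists (M1 + M2) => [|x]; first exact: addr_ge0.
  by rewrite (le_trans (ler_normD _ _))// lerD.
- exists (`|c| * M) => [|x]; first by rewrite mulr_ge0.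
  by rewrite normrM ler_wpM2l.
Qed.

Lemma integrable_mul_bounded (mu : {measure set V -> \bar R}) (k f : V -> R) M :
  mu.-integrable setT (EFin \o k) -> measurable_fun setT f ->
  (forall x, `|f x| <= M) -> mu.-integrable setT (EFin \o (fun x => k x * f x)).
Proof.
move=> ik mf fM; have [mk _] := integrableP _ _ _ ik.
apply: (@le_integrable _ _ _ _ _ measurableT _ (fun x => M%:E * (EFin \o k) x)%E).
- apply/measurable_EFinP/measurable_funM => //; exact/measurable_EFinP.
- move=> x _ /=; rewrite lee_fin !normrM mulrC ler_wpM2r//.
  by rewrite (le_trans (fM x))// ler_norm.
- exact: integrableZl.
Qed.

End trigonometric_polynomials.

Section levy_integrals.
Context (R : realType) (d : nat) (nu : {measure set 'rV[R]_d -> \bar R}).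
Hypothesis nu_levy : symmetric_levy_measure nu.
Local Notation V := 'rV[R]_d.

Lemma measurable_one_sub_cos (xi : V) :
  measurable_fun setT (fun x : V => 1 - cos (dotp xi x)).
Proof.
apply: measurable_funB; first exact: measurable_cst.
by have := measurable_cos_dotp xi 0; under eq_fun do rewrite addr0.
Qed.

(** [Phi] is a real-valued integral and behaves linearly only thanks to this. In the constant 2 +
    K^2, the 2 handles |y| >= 1 and K^2 handles |y| < 1. *)
Lemma integrable_one_sub_cos xi :
  nu.-integrable setT (EFin \o (fun x => 1 - cos (dotp xi x))).
Proof.
have [_ nu_fin _] := nu_levy.
pose K : R := \sum_i `|xi 0 i|.
have mmin : measurable_fun setT (fun y : V => Num.min 1 (enorm y ^+ 2)).
  apply: measurable_minr; first exact: measurable_cst.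
  by apply: measurable_funX; exact: measurable_enorm.
have min0 (y : V) : 0 <= Num.min 1 (enorm y ^+ 2) by rewrite le_min ler01 sqr_ge0.
apply: (@le_integrable _ _ _ _ _ measurableT _
  (fun y => (2 + K ^+ 2)%:E * (Num.min 1 (enorm y ^+ 2))%:E)%E).
- by apply/measurable_EFinP; exact: measurable_one_sub_cos.
- move=> x _ /=; rewrite lee_fin !ger0_norm ?one_sub_cos_ge0//; last first.
    by rewrite mulr_ge0// addr_ge0// sqr_ge0.
  rewrite minEle; case: ifPn => [_|_].
    by have := cos_geN1 (dotp xi x); have := sqr_ge0 K; lra.
  apply: le_trans (one_sub_cos_le _) _; apply: le_trans (dotp_sqr_le _ _) _.
  by rewrite ler_wpM2r ?sqr_ge0// lerDr.
- apply: integrableZl => //; apply/integrableP; split; first exact/measurable_EFinP.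
  by under eq_integral do rewrite /= ger0_norm//.
Qed.

(** The reflection x -> -x preserves nu and changes the sign of S, so the integral equals its own
    negative. *)
Lemma integral_odd (S : V -> R) : nu.-integrable setT (EFin \o S) ->
  (forall x, S (- x) = - S x) -> \int[nu]_x S x = 0.
Proof.
move=> iS oddS; have [_ _ nu_sym] := nu_levy.
have iSN : nu.-integrable setT ((EFin \o S) \o (fun x : V => - x)).
  rewrite (_ : _ \o _ = -%E \o (EFin \o S)); first exact: integrableN.
  by apply/funext => x /=; rewrite oddS.
have /integrableP[mS _] := iS.
have : (\int[nu]_x (EFin \o S) x = \int[nu]_x ((EFin \o S) \o (fun x : V => - x)%R) x)%E.
  rewrite -(integral_pushforward (@measurable_oppV R d) mS iSN measurableT).
  apply/esym; apply: (@eq_measure_integral _ _ _ _ nu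
   (pushforward_measure nu (@measurable_oppV R d))).
  move=> A mA _; rewrite -[RHS]nu_sym//; congr (nu _).
  apply/seteqP; split => x /= Ax; first by exists (- x); rewrite ?opprK.
  by case: Ax => y Ay <-; rewrite opprK.
move=> /(congr1 fine); rewrite -[LHS]/(\int[nu]_x S x).
have -> : fine (\int[nu]_x ((EFin \o S) \o (fun x : V => - x)%R) x)%E = \int[nu]_x (-1 * S x).
  by congr fine; apply: eq_integral => x _ /=; rewrite oddS mulN1r.
rewrite RintegralZl//; lra.
Qed.

Lemma Phi_ge0 xi : 0 <= Phi nu xi.
Proof. by apply: Rintegral_ge0 => x _; exact: one_sub_cos_ge0. Qed.

End levy_integrals.

Section real_integrable.
Context d (T : measurableType d) (R : realType) (mu : {measure set T -> \bar R}).
Implicit Types f g : T -> R.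
Local Notation int f := (mu.-integrable setT (EFin \o f)).

Lemma integrable_addr f g : int f -> int g -> int (fun x => f x + g x).
Proof. by move=> fi gi; exact: (integrableD measurableT fi gi). Qed.

Lemma integrable_subr f g : int f -> int g -> int (fun x => f x - g x).
Proof. by move=> fi gi; exact: (integrableB measurableT fi gi). Qed.

Lemma integrable_scaler c f : int f -> int (fun x => c * f x).
Proof. by move=> fi; exact: (integrableZl measurableT c fi). Qed.

End real_integrable.

(** The constants cancel because 1 - 1/2 - 1/2 = 0, so only the terms of order u are left. It is
    applied with p, q, r the values of Phi at xi, xi + eta, xi - eta. *)
Lemma expR_second_difference (R : realType) (u p q r : R) :
  0 <= u -> 0 <= p -> 0 <= q -> 0 <= r ->
  `|expR (- u * p) - 2^-1 * expR (- u * q) - 2^-1 * expR (- u * r) -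
    u * (2^-1 * q + 2^-1 * r - p)| <= (p ^+ 2 + 2^-1 * q ^+ 2 + 2^-1 * r ^+ 2) * u ^+ 2.
Proof.
move=> u0 p0 q0 r0.
have := expRN_approx (mulr_ge0 u0 p0); have := expRN_approx (mulr_ge0 u0 q0).
have := expRN_approx (mulr_ge0 u0 r0); rewrite -!mulNr !exprMn.
move: (expR _) (expR _) (expR _) => A B C.
rewrite !ler_norml => /andP[? ?] /andP[? ?] /andP[? ?].
by apply/andP; split; lra.
Qed.

Section small_time.
Context (R : realType) (d : nat) (nu : {measure set 'rV[R]_d -> \bar R}).
Context (P : R -> probability 'rV[R]_d R).
Hypotheses (nu_levy : symmetric_levy_measure nu) (P_nu : levy_semigroup nu P).
Local Notation V := 'rV[R]_d.

Lemma semigroup_cos t xi : 0 <= t ->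
  \int[P t]_x cos (dotp xi x) = expR (- t * Phi nu xi).
Proof. by move=> t0; have [_ /(_ t xi t0)[]] := P_nu. Qed.

Lemma semigroup_sin t xi : 0 <= t -> \int[P t]_x sin (dotp xi x) = 0.
Proof. by move=> t0; have [_ /(_ t xi t0)[]] := P_nu. Qed.

Lemma probability_integrable_bounded (mu : probability V R) (f : V -> R) M :
  measurable_fun setT f -> (forall x, `|f x| <= M) -> mu.-integrable setT (EFin \o f).
Proof.
move=> mf fM.
have i1 : mu.-integrable setT (EFin \o (cst 1 : V -> R)).
  exact: finite_measure_integrable_cst.
by have := integrable_mul_bounded i1 mf fM; under eq_fun do rewrite mul1r.
Qed.

Lemma integrable_cos_dotp (mu : probability V R) xi th :
  mu.-integrable setT (EFin \o (fun x : V => cos (dotp xi x + th))).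
Proof.
apply: (@probability_integrable_bounded _ _ 1); first exact: measurable_cos_dotp.
by move=> x; exact: cos_max.
Qed.

Lemma semigroup_cos_phase t xi th : 0 <= t ->
  \int[P t]_x cos (dotp xi x + th) = cos th * expR (- t * Phi nu xi).
Proof.
move=> t0.
have ic : (P t).-integrable setT (EFin \o (fun x : V => cos (dotp xi x))).
  by have := integrable_cos_dotp (P t) xi 0; under eq_fun do rewrite addr0.
have is_ : (P t).-integrable setT (EFin \o (fun x : V => sin (dotp xi x))).
  have := integrable_cos_dotp (P t) xi (- (pi / 2)).
  by under eq_fun do rewrite cosBpihalf.
transitivity (\int[P t]_x (cos th * cos (dotp xi x) - sin th * sin (dotp xi x))).
  by apply: eq_Rintegral => x _; rewrite cosD; ring.
rewrite RintegralB//; [|exact: integrable_scaler|exact: integrable_scaler].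
by rewrite !RintegralZl// semigroup_cos// semigroup_sin// mulr0 subr0.
Qed.

(** The product is rewritten through terms of the form 1 - cos, each nu-integrable; cosines alone
    need not be, as nu may be infinite. The sine part is odd and integrates to 0. *)
Lemma levy_cos_phase eta xi th :
  \int[nu]_x ((1 - cos (dotp eta x)) * cos (dotp xi x + th)) =
  cos th * (2^-1 * Phi nu (xi + eta) + 2^-1 * Phi nu (xi - eta) - Phi nu xi).
Proof.
have i1 z := integrable_one_sub_cos nu_levy z.
have iS : nu.-integrable setT
    (EFin \o (fun x => (1 - cos (dotp eta x)) * sin (dotp xi x))).
  apply: (integrable_mul_bounded (M := 1)) => //; last by move=> x; exact: sin_max.
  have := measurable_cos_dotp xi (- (pi / 2)).
  by under eq_fun do rewrite cosBpihalf.
transitivity (\int[nu]_x (cos th * ((2^-1 * (1 - cos (dotp (xi + eta) x)) +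
    2^-1 * (1 - cos (dotp (xi - eta) x))) - (1 - cos (dotp xi x))) -
    sin th * ((1 - cos (dotp eta x)) * sin (dotp xi x)))).
  apply: eq_Rintegral => x _; rewrite !dotpDl dotpNl.
  by move: (dotp eta x) (dotp xi x) => a b; rewrite cosB !cosD; field.
have i2 : nu.-integrable setT (EFin \o (fun x => 2^-1 * (1 - cos (dotp (xi + eta) x)) +
    2^-1 * (1 - cos (dotp (xi - eta) x)))).
  by apply: integrable_addr; apply: integrable_scaler.
have i3 := integrable_subr i2 (i1 xi).
rewrite RintegralB//; [|exact: integrable_scaler|exact: integrable_scaler].
rewrite !RintegralZl// (integral_odd nu_levy iS) ?mulr0 ?subr0; last first.
  by move=> x; rewrite !dotpNr cosN sinN mulrN.
congr (_ * _).
rewrite RintegralB// RintegralD//; [|exact: integrable_scaler|exact: integrable_scaler].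
by rewrite !RintegralZl.
Qed.

(* The bound is uniform in z, so it survives integration over the position
   reached by the other increments. *)
Lemma trig_small_time eta f : trig f -> exists2 C : R, 0 <= C & forall (u : R) (z : V), 0 <= u ->
  `|\int[P u]_x ((1 - cos (dotp eta x)) * f (z + x)) -
    u * \int[nu]_x ((1 - cos (dotp eta x)) * f (z + x))| <= C * u ^+ 2.
Proof.
have i1 := integrable_one_sub_cos nu_levy eta.
have m1 := measurable_one_sub_cos eta.
have iP u : (P u).-integrable setT (EFin \o (fun x => 1 - cos (dotp eta x))).
  apply: (@probability_integrable_bounded _ _ 2) => // x.
  by have := cos_le1 (dotp eta x); have := cos_geN1 (dotp eta x) => ? ?; rewrite ger0_norm; lra.
have trig_int (mu : {measure set V -> \bar R}) g (z : V) :
    mu.-integrable setT (EFin \o (fun x => 1 - cos (dotp eta x))) -> trig g ->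
    mu.-integrable setT (EFin \o (fun x => (1 - cos (dotp eta x)) * g (z + x))).
  move=> im tg; have [M M0 gM] := trig_bounded tg.
  apply: (integrable_mul_bounded (M := M)) => //.
  exact: measurableT_comp (measurable_trig tg) (measurable_shiftV z).
have tP u g z := trig_int (P u) g z (iP u).
have tnu g z := trig_int nu g z i1.
elim=> [xi th|g1 g2 tg1 [C1 C10 H1] tg2 [C2 C20 H2]|c g tg [C C0 H]].
- exists (Phi nu xi ^+ 2 + 2^-1 * Phi nu (xi + eta) ^+ 2 + 2^-1 * Phi nu (xi - eta) ^+ 2).
    by rewrite !addr_ge0 ?mulr_ge0 ?sqr_ge0 ?Phi_ge0.
  move=> u z u0.
  have shiftE x : cos (dotp xi (z + x) + th) = cos (dotp xi x + (dotp xi z + th)).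
    by rewrite dotpDr addrAC addrA [in LHS]addrC addrA addrAC.
  under eq_Rintegral do rewrite shiftE.
  under [X in _ * X]eq_Rintegral do rewrite shiftE.
  rewrite levy_cos_phase; move: (dotp xi z + th) => {shiftE}th.
  have -> : \int[P u]_x ((1 - cos (dotp eta x)) * cos (dotp xi x + th)) =
      cos th * (expR (- u * Phi nu xi) - 2^-1 * expR (- u * Phi nu (xi + eta))
        - 2^-1 * expR (- u * Phi nu (xi - eta))).
    transitivity (\int[P u]_x (cos (dotp xi x + th) - 2^-1 * cos (dotp (xi + eta) x + th)
        - 2^-1 * cos (dotp (xi - eta) x + th))).
      apply: eq_Rintegral => x _; rewrite !dotpDl dotpNl.
      move: (dotp eta x) (dotp xi x) => a b.
      by rewrite (addrAC b a) (addrAC b (- a)) cosB (cosD (b + th) a); field.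
    have ic z' := integrable_cos_dotp (P u) z' th.
    rewrite RintegralB//; [|apply: integrable_subr => //|]; try exact: integrable_scaler.
    rewrite RintegralB//; last exact: integrable_scaler.
    rewrite RintegralZl; [|exact: measurableT|exact: ic].
    rewrite RintegralZl; [|exact: measurableT|exact: ic].
    rewrite !semigroup_cos_phase//.
    move: (expR _) (expR _) (expR _) (cos th) => A B C D.
    by ring.
  (* Both integrals carry the factor [cos th], through which alone the translation z enters; |cos
     th| <= 1 makes the bound uniform in z. *)
  rewrite mulrCA -mulrBr normrM.
  apply: le_trans (expR_second_difference u0 (Phi_ge0 nu xi)
    (Phi_ge0 nu (xi + eta)) (Phi_ge0 nu (xi - eta))).
  by apply: ler_piMl; [exact: normr_ge0|exact: cos_max].
- exists (C1 + C2) => [|u z u0]; first exact: addr_ge0.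
  have -> : \int[P u]_x ((1 - cos (dotp eta x)) * (g1 (z + x) + g2 (z + x))) =
     \int[P u]_x ((1 - cos (dotp eta x)) * g1 (z + x)) +
     \int[P u]_x ((1 - cos (dotp eta x)) * g2 (z + x)).
    rewrite -RintegralD//; [|exact: tP|exact: tP].
    by apply: eq_Rintegral => x _; rewrite mulrDr.
  have -> : \int[nu]_x ((1 - cos (dotp eta x)) * (g1 (z + x) + g2 (z + x))) =
     \int[nu]_x ((1 - cos (dotp eta x)) * g1 (z + x)) +
     \int[nu]_x ((1 - cos (dotp eta x)) * g2 (z + x)).
    rewrite -RintegralD//; [|exact: tnu|exact: tnu].
    by apply: eq_Rintegral => x _; rewrite mulrDr.
  rewrite mulrDr opprD addrACA mulrDl (le_trans (ler_normD _ _))//.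
  by apply: lerD; [exact: H1|exact: H2].
- exists (`|c| * C) => [|u z u0]; first by rewrite mulr_ge0.
  have cE x : (1 - cos (dotp eta x)) * (c * g (z + x)) =
     c * ((1 - cos (dotp eta x)) * g (z + x)) by rewrite mulrCA.
  under eq_Rintegral do rewrite cE.
  under [X in _ * X]eq_Rintegral do rewrite cE.
  rewrite RintegralZl//; last exact: tP.
  rewrite RintegralZl//; last exact: tnu.
  by rewrite mulrCA -mulrBr normrM -mulrA ler_wpM2l// H.
Qed.

End small_time.

(** * Lower bound against trigonometric polynomials *)

Section concentration.
Context (R : realType) (d : nat) (P : R -> probability 'rV[R]_d R).
Hypothesis P_conv : convolution_semigroup P.
Local Notation V := 'rV[R]_d.

Lemma normr_coord_le (x : V) i : `|x 0 i| <= `|x|.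
Proof.
rewrite [leRHS]mx_normrE.
exact: (le_bigmax _ (fun i : 'I_1 * 'I_d => `|x i.1 i.2|) (0, i)).
Qed.

Lemma normr_le_coord (x : V) (a : R) : 0 <= a -> (forall i, `|x 0 i| <= a) -> `|x| <= a.
Proof.
move=> a0 xa; rewrite [leLHS]mx_normrE; apply: bigmax_le => // -[i j] _ /=.
by rewrite ord1.
Qed.

Lemma hcube_normr (c : V) (r : R) x : 0 <= r -> hcube c r x -> `|x - c| <= r.
Proof.
by move=> r0 /hcube_norm xc; apply: normr_le_coord => // i; rewrite !mxE.
Qed.

Lemma continuous_lt_ball (g : V -> R) (x : V) (a : R) : continuous g -> g x < a ->
  exists2 r : R, 0 < r & forall y, `|y - x| <= r -> g y < a.
Proof.
move=> cg gxa; have /cvgrPdist_lt/(_ (a - g x)) := cg x; rewrite subr_gt0 => /(_ gxa).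
move=> /nbhs_ballP[e /= e0 He]; exists (e / 2) => [|y ye]; first by rewrite divr_gt0.
have := He y; rewrite -ball_normE/= distrC => /(_ (le_lt_trans ye _)).
have e2 : e / 2 < e by lra.
by move=> /(_ e2); rewrite distrC => /(le_lt_trans (ler_norm _)); rewrite ltrBlDr subrK.
Qed.

(** The tent function [f] equals 1 at 0 and lies below the indicator of the cube, so weak continuity
    at time 0 suffices. The value 3/4 leaves 1/4 for the discarded jumps. *)
Lemma semigroup_concentrates (rho : R) : 0 < rho -> exists2 s0 : R, 0 < s0 &
  forall s : R, 0 < s -> s <= s0 -> ((3 / 4)%:E <= P s (hcube 0 rho))%E.
Proof.
move=> rho0; have [_ _ Pcvg] := P_conv.
pose f (x : V) := Num.max 0 (1 - rho^-1 * `|x|) : R.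
have cf : continuous f.
  move=> x; apply: (@continuous_max R V (cst 0) (fun y : V => 1 - rho^-1 * `|y|) x).
    exact: cst_continuous.
  apply: (@continuousB R R^o V (cst 1) (fun y : V => rho^-1 * `|y|) x).
    exact: cst_continuous.
  apply: (@continuousM R V (cst rho^-1) (fun y : V => `|y|) x).
    exact: cst_continuous.
  exact: norm_continuous.
have f01 x : 0 <= f x <= 1.
  rewrite /f le_max lexx/= ge_max ler01/= gerBl mulr_ge0// invr_ge0; exact: ltW.
have f0 : f 0 = 1 by rewrite /f normr0 mulr0 subr0 max_r.
have fb : exists M : R, forall x, `|f x| <= M.
  by exists 1 => x; case/andP: (f01 x) => ? ?; rewrite ger0_norm.
have := Pcvg f cf fb; rewrite f0 => /cvgrPdist_lt/(_ (1 / 4)) H.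
have /H{H} : 0 < 1 / 4 :> R by [].
rewrite near_withinE => -[e /= e0 He].
exists (e / 2); first by rewrite divr_gt0.
move=> s s0 se.
have : `|1 - \int[P s]_x f x| < 1 / 4.
  apply: He => //=; rewrite sub0r normrN gtr0_norm//; lra.
rewrite ltr_norml => /andP[_ h].
have mf : measurable_fun setT f by exact: measurable_fun_continuous.
have If : (\int[P s]_x (f x)%:E <= P s (hcube 0 rho))%E.
  have mc := measurable_hcube (0 : V) rho.
  have E : (\int[P s]_x (\1_(hcube 0 rho) x)%:E = P s (hcube 0 rho))%E.
    by rewrite integral_indic// setIT.
  rewrite -E.
  apply: ge0_le_integral => //.
  - by move=> x _; rewrite lee_fin; case/andP: (f01 x).
  - exact/measurable_EFinP.
  - by apply/measurable_EFinP; exact: measurable_indic.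
  - move=> x _; rewrite lee_fin indicE; have [xc|xc] := boolP (x \in hcube 0 rho).
      by case/andP: (f01 x).
    rewrite /f max_l// subr_le0 leNgt; apply/negP => xr; move/negP: xc; apply.
    rewrite inE; apply: norm_hcube => i; rewrite mxE subr0.
    apply: le_lt_trans (normr_coord_le x i) _.
    by move: xr; rewrite mulrC ltr_pdivrMr// mul1r.
apply: le_trans If.
rewrite -(@fineK _ (\int[P s]_x (f x)%:E)%E).
  by rewrite lee_fin; move: h; rewrite /Rintegral; lra.
rewrite ge0_fin_numE; last by apply: integral_ge0 => x _; rewrite lee_fin; case/andP: (f01 x).
apply: le_lt_trans (_ : (_ <= \int[P s]_x (cst 1 x)%:E)%E) _; last first.
  by rewrite integral_one ltry.
apply: ge0_le_integral => //.
- by move=> x _; rewrite lee_fin; case/andP: (f01 x).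
- exact/measurable_EFinP.
- by apply/measurable_EFinP; exact: measurable_cst.
- by move=> x _; rewrite lee_fin; case/andP: (f01 x).
Qed.

End concentration.

Section measure_domination.
Context d (T : measurableType d) (R : realType).
Variables mu nu : {measure set T -> \bar R}.

Lemma ge0_le_dominated_integral (eps : R) (D : set T) (f : T -> \bar R) :
  0 <= eps -> measurable D ->
  (forall A, measurable A -> A `<=` D -> (eps%:E * mu A <= nu A)%E) ->
  measurable_fun setT f -> (forall x, 0 <= f x)%E ->
  (eps%:E * \int[mu]_(x in D) f x <= \int[nu]_(x in D) f x)%E.
Proof.
move=> eps0 mD epsD mf f0.
(* The hypothesis compares the measures only inside D; after restricting mu to D it holds on all
   sets. *)
have -> : (\int[mu]_(x in D) f x = \int[mrestr mu mD]_(x in D) f x)%E.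
  by apply: eq_measure_integral => A mA AD; rewrite /= /mrestr setIidl.
pose k := NngNum eps0.
rewrite -[eps%:E]/(k%:num%:E) -ge0_integral_mscale//; last exact: measurable_funTS.
apply: ge0_le_measure_integral => // A mA.
rewrite /= /mscale/= /mrestr; apply: le_trans (epsD _ _ _) _.
- exact: measurableI.
- exact: subIsetr.
- by apply: le_measure; rewrite ?inE//; exact: measurableI.
Qed.

End measure_domination.

Section jump_lower_bound.
Context (R : realType) (d : nat) (nu : {measure set 'rV[R]_d -> \bar R}).
Context (P : R -> probability 'rV[R]_d R).
Hypotheses (nu_levy : symmetric_levy_measure nu) (P_nu : levy_semigroup nu P).
Local Notation V := 'rV[R]_d.
Local Notation m := (lebesgue_rV R d).
Variables (v eta : V) (rho eps : R).
Hypotheses (rho0 : 0 < rho) (eps0 : 0 < eps).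
Hypothesis v_eta : forall x, hcube v (2 * rho) x -> 1 <= 1 - cos (dotp eta x).
Hypothesis nu_lower : forall A : set V, measurable A -> A `<=` hcube v (2 * rho) ->
  (eps%:E * m A <= nu A)%E.

(** The factor 1/2 brings the values into [0,1]. By [v_eta], w >= 1/2 on the cube of radius 2 rho,
    whence the [2^-1] in the bounds below. *)
Let w (x : V) : R := 2^-1 * (1 - cos (dotp eta x)).

Let mw : measurable_fun setT w.
Proof.
by apply: measurable_funM; [exact: measurable_cst|exact: measurable_one_sub_cos].
Qed.

Let w01 x : 0 <= w x <= 1.
Proof.
have := cos_le1 (dotp eta x); have := cos_geN1 (dotp eta x); rewrite /w => ? ?.
by apply/andP; split; lra.
Qed.

Let w0 x : 0 <= w x. Proof. by case/andP: (w01 x). Qed.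

Section test_function.
Variable f : V -> R.
Hypotheses (tf : trig f) (f0 : forall x, 0 <= f x).

Let mf : measurable_fun setT f. Proof. exact: measurable_trig. Qed.
Let mfz (z : V) : measurable_fun setT (fun x => f (z + x)).
Proof. exact: measurableT_comp mf (measurable_shiftV z). Qed.

Let I : R := fine (\int[m]_(x in hcube v rho) (f x)%:E)%E.

Let bounded_integral_fin (mu : {measure set V -> \bar R}) D :
  measurable D -> (mu D < +oo)%E -> (\int[mu]_(x in D) (f x)%:E)%E \is a fin_num.
Proof.
move=> mD muD; have [M M0 fM] := trig_bounded tf.
rewrite ge0_fin_numE; last by apply: integral_ge0 => x _; rewrite lee_fin.
apply: (@le_lt_trans _ _ (\int[mu]_(x in D) (cst M x)%:E)%E).
  apply: ge0_le_integral => //.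
  - by move=> x _; rewrite lee_fin.
  - by apply/measurable_EFinP; exact: measurable_funTS.
  - by apply/measurable_EFinP; exact: measurable_cst.
  - by move=> x _; rewrite lee_fin (le_trans _ (fM x))// ler_norm.
rewrite /= integral_cst// lte_mul_pinfty// lee_fin//.
Qed.

Let IE : (\int[m]_(x in hcube v rho) (f x)%:E = I%:E)%E.
Proof.
rewrite /I fineK//; apply: bounded_integral_fin; first exact: measurable_hcube.
exact/lebesgue_hcube_lty/ltW.
Qed.

(** For z within rho of 0, the cube of radius 2 rho about v, shifted by z, still contains the cube
    of radius rho about v. This is why the jump region has radius 2 rho. *)
Lemma jump_intensity z : hcube 0 rho z ->
  2^-1 * eps * I <= \int[nu]_x (w x * f (z + x)).
Proof.
move=> zr; have [M M0 fM] := trig_bounded tf.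
have iw : nu.-integrable setT (EFin \o (fun x => w x * f (z + x))).
  apply: (integrable_mul_bounded (M := M)) => //.
  by apply: integrable_scaler; exact: integrable_one_sub_cos.
suff : ((2^-1 * eps * I)%:E <= \int[nu]_x (w x * f (z + x))%:E)%E.
  rewrite -(@fineK _ (\int[nu]_x (w x * f (z + x))%:E)%E) ?lee_fin//.
  exact: integrable_fin_num.
have mwf : measurable_fun setT (fun x => (w x * f (z + x))%:E).
  by apply/measurable_EFinP; exact: measurable_funM.
have mc := measurable_hcube v (2 * rho).
have wf0 x : (0 <= (w x * f (z + x))%:E)%E by rewrite lee_fin mulr_ge0.
apply: (@le_trans _ _ (\int[nu]_(x in hcube v (2 * rho)) (w x * f (z + x))%:E)%E); last first.
  exact: ge0_subset_integral.
apply: le_trans (ge0_le_dominated_integral (ltW eps0) mc nu_lower mwf wf0).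
rewrite mulrAC mulrC EFinM lee_pmul2l//.
have mzf : measurable_fun setT (fun x => (f (z + x))%:E) by exact/measurable_EFinP.
apply: (@le_trans _ _ (\int[m]_(x in hcube v (2 * rho)) (2^-1%:E * (f (z + x))%:E))%E); last first.
  apply: ge0_le_integral => //.
  - by move=> x _; rewrite mule_ge0// lee_fin.
  - by apply/emeasurable_funM => //; exact: measurable_funTS.
  - exact: measurable_funTS.
  - move=> x /v_eta xv; rewrite -EFinM lee_fin ler_wpM2r// /w; lra.
rewrite ge0_integralZl//; last 2 first.
- exact: measurable_funTS.
- by move=> x _; rewrite lee_fin.
rewrite EFinM lee_pmul2l// -IE [leLHS]integral_mkcond [leRHS]integral_mkcond.
(* The integrand cut off to the shifted cube, so that translation invariance on the whole space
   applies. *)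
pose G (y : V) : \bar R := ((fun x => (f x)%:E) \_ (hcube (z + v) (2 * rho))) y.
have -> : (\int[m]_x ((fun x => (f (z + x))%:E) \_ (hcube v (2 * rho))) x =
    \int[m]_x G (z + x)%R)%E.
  apply: eq_integral => x _; rewrite /G !patchE.
  have -> // : (x \in hcube v (2 * rho)) = (z + x \in hcube (z + v) (2 * rho)).
  by apply/idP/idP; rewrite !inE => /hcube_shift.
have mG : measurable_fun setT G.
  apply/(measurable_restrictT _ (measurable_hcube _ _)); apply: measurable_funTS.
  exact/measurable_EFinP.
have G0 x : (0 <= G x)%E by rewrite /G patchE; case: ifPn => // _; rewrite lee_fin.
rewrite ge0_integral_lebesgue_rV_shift//.
apply: ge0_le_integral => //.
- by move=> x _; rewrite patchE; case: ifPn => // _; rewrite lee_fin.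
- apply/(measurable_restrictT _ (measurable_hcube _ _)); apply: measurable_funTS.
  exact/measurable_EFinP.
- move=> x _; rewrite /G !patchE; case: ifPn => [|_]; last by case: ifPn => // _; rewrite lee_fin.
  rewrite inE => xv; rewrite ifT// inE => i; have := xv i; have := zr i.
  rewrite !mxE !in_itv/= => /andP[? ?] /andP[? ?]; apply/andP; split; lra.
Qed.

(** With the indicator, the bound becomes an inequality between functions of the position z, which
    monotone averaging over the other increments preserves. *)
Lemma jump_part_lower_bound : exists2 C : R, 0 <= C & forall (u : R) (z : V), 0 <= u ->
  ((u * (2^-1 * eps * I))%:E * (\1_(hcube 0 rho) z)%:E <=
    wshift (P u) w (EFin \o f) z + (C * u ^+ 2)%:E)%E.
Proof.
have [C C0 HC] := trig_small_time nu_levy P_nu eta tf.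
exists C => // u z u0; have [zr|zr] := pselect (hcube 0 rho z); last first.
  rewrite indicE memNset// mule0 adde_ge0//; last by rewrite lee_fin mulr_ge0// sqr_ge0.
  by apply: wshift_ge0 => // x; rewrite lee_fin.
rewrite indicE mem_set// mule1.
have [M M0 fM] := trig_bounded tf.
have i1 : (P u).-integrable setT (EFin \o (fun x : V => 1 - cos (dotp eta x))).
  apply: (@probability_integrable_bounded _ _ _ _ 2); first exact: measurable_one_sub_cos.
  move=> x; have := cos_le1 (dotp eta x); have := cos_geN1 (dotp eta x) => ? ?.
  by rewrite ger0_norm; lra.
have i1f : (P u).-integrable setT (EFin \o (fun x : V => (1 - cos (dotp eta x)) * f (z + x))).
  exact: (integrable_mul_bounded (M := M)).
have inf : nu.-integrable setT (EFin \o (fun x : V => (1 - cos (dotp eta x)) * f (z + x))).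
  by apply: (integrable_mul_bounded (M := M)) => //; exact: integrable_one_sub_cos.
have -> : wshift (P u) w (EFin \o f) z =
    (2^-1 * \int[P u]_x ((1 - cos (dotp eta x)) * f (z + x)))%:E.
  rewrite -RintegralZl// /Rintegral fineK.
    by apply: eq_integral => x _; rewrite /= -EFinM mulrA.
  by apply: integrable_fin_num => //; exact: integrable_scaler.
have := HC u z u0; rewrite ler_norml => /andP[h _].
have := jump_intensity zr.
have -> : \int[nu]_x (w x * f (z + x)) =
    2^-1 * \int[nu]_x ((1 - cos (dotp eta x)) * f (z + x)).
  by rewrite -RintegralZl//; apply: eq_Rintegral => x _; rewrite /w mulrA.
move=> /(ler_wpM2l u0) h2.
rewrite -EFinD lee_fin.
have := mulr_ge0 C0 (sqr_ge0 u).
move: h h2; set A := \int[P u]_x _; set B := \int[nu]_x _; lra.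
Qed.

Lemma small_time_test_bound (s0 s : R) :
  (forall t, 0 < t -> t <= s0 -> ((3 / 4)%:E <= P t (hcube 0 rho))%E) ->
  0 < s -> s <= s0 -> s * Phi nu eta <= 2^-1 ->
  ((4^-1 * eps * s)%:E * (\int[m]_(x in hcube v rho) (f x)%:E) <= \int[P s]_x (f x)%:E)%E.
Proof.
move=> Ps0 s_gt0 ss0 sPhi; have [C C0 HC] := jump_part_lower_bound.
have [P_conv _] := P_nu.
have fE0 x : (0 <= (EFin \o f) x)%E by rewrite lee_fin.
have mfE : measurable_fun setT (EFin \o f) by exact/measurable_EFinP.
have F_fin : (\int[P s]_x (f x)%:E)%E \is a fin_num.
  apply: (@bounded_integral_fin (P s)) => //.
  by rewrite (le_lt_trans (probability_le1 _ measurableT))// ltry.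
set F := fine (\int[P s]_x (f x)%:E)%E.
have FE : (\int[P s]_x (f x)%:E = F%:E)%E by rewrite fineK.
have I0 : 0 <= I by apply: fine_ge0; apply: integral_ge0 => x _; rewrite lee_fin.
rewrite IE FE -EFinM lee_fin.
(* Time s is cut into n+2 increments: one jump and n+1 >= 1 small ones, so the latter have a
   positive total duration. The factor 4^-1 is 1/2 from w times 1/2 from the mass that stays near
   0. *)
suff H n : s * (4^-1 * eps * I) - C * s ^+ 2 / n.+2%:R <= F.
  rewrite (_ : 4^-1 * eps * s * I = s * (4^-1 * eps * I)); last by ring.
  apply/ler_addgt0Pr => e e0.
  have Cs0 : 0 < C * s ^+ 2 + 1 by rewrite ltr_wpDl// mulr_ge0// sqr_ge0.
  have [n _ Hn] := near_infty_natSinv_lt (PosNum (divr_gt0 e0 Cs0)).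
  have {Hn} := Hn n.+1 (leqnSn n).
  rewrite /= ltr_pdivlMr//.
  have : 0 < (n.+2%:R)^-1 :> R by rewrite invr_gt0.
  by have := H n; set q := (n.+2%:R)^-1; nra.
pose u := s / n.+2%:R.
have n20 : 0 < n.+2%:R :> R by [].
have u0 : 0 < u by rewrite divr_gt0.
have su : n.+2%:R * u = s by rewrite /u mulrCA divff ?mulr1// gt_eqF.
pose A := wshift (P u) (fun x => 1 - w x).
pose g1 (z : V) := (\1_(hcube 0 rho) z)%:E : \bar R.
have mg1 : measurable_fun setT g1.
  by apply/measurable_EFinP; apply: measurable_indic; exact: measurable_hcube.
have g10 x : (0 <= g1 x)%E by rewrite lee_fin.
have g101 x : (0 <= g1 x <= 1)%E by rewrite g10/= lee_fin indicE lern1 leq_b1.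
have v0 x : 0 <= 1 - w x by rewrite subr_ge0; case/andP: (w01 x).
have mv : measurable_fun setT (fun x => 1 - w x).
  by apply: measurable_funB => //; exact: measurable_cst.
pose Bf := wshift (P u) w (EFin \o f).
have mBf : measurable_fun setT Bf by exact: measurable_wshift.
have Bf0 x : (0 <= Bf x)%E by exact: wshift_ge0.
have kappa0 : 0 <= u * (2^-1 * eps * I) by rewrite !mulr_ge0// ltW.
have Cu0 : 0 <= C * u ^+ 2 by rewrite mulr_ge0// sqr_ge0.
pose X := iter n.+1 A Bf 0.
have X0 : (0 <= X)%E by exact: iter_wshift_ge0.
have XF : (n.+2%:R%:E * X <= F%:E)%E.
  have <- : (\int[P (n.+2%:R * u)%R]_x (EFin \o f) (0 + x)%R = F%:E)%E.
    by rewrite su -FE; apply: eq_integral => x _; rewrite add0r.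
  rewrite -(iter_wshift_semigroup P_conv n.+1 (ltW u0) mfE fE0 0).
  exact: iter_wshift_one_jump.
have X_fin : X \is a fin_num.
  rewrite ge0_fin_numE//; apply: le_lt_trans (ltry F); apply: le_trans XF.
  by rewrite -[leLHS]mul1e lee_wpmul2r// lee_fin ler1n.
(* Concentration gives 3/4 at time (n+1)u <= s, and the jumps take away at most (n+1) u Phi(eta)/2
   <= 1/4. *)
have stay : ((1 / 2)%:E <= iter n.+1 A g1 0%R)%E.
  have h1 := iter_wshift_jump_mass (P u) mw w01 n.+1 mg1 g101 0.
  rewrite (iter_wshift_semigroup P_conv n (ltW u0) mg1 g10 0) in h1.
  have nu_s : n.+1%:R * u <= s by rewrite -su ler_pM2r// ler_nat.
  have h2 := Ps0 (n.+1%:R * u) (mulr_gt0 (ltr0Sn R n) u0) (le_trans nu_s ss0).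
  have E : (\int[P (n.+1%:R * u)%R]_x g1 (0 + x)%R = P (n.+1%:R * u)%R (hcube 0 rho))%E.
    transitivity (\int[P (n.+1%:R * u)%R]_x g1 x)%E.
      by apply: eq_integral => x _; rewrite add0r.
    by rewrite integral_indic ?setIT//; exact: measurable_hcube.
  rewrite E in h1.
  have wE : (\int[P u]_x (w x)%:E)%E = (2^-1 * (1 - expR (- u * Phi nu eta)))%:E.
    have ic : (P u).-integrable setT (EFin \o (fun x : V => cos (dotp eta x))).
      by have := integrable_cos_dotp (P u) eta 0; under eq_fun do rewrite addr0.
    have i1 : (P u).-integrable setT (EFin \o (cst 1 : V -> R)).
      exact: finite_measure_integrable_cst.
    rewrite -(semigroup_cos P_nu _ (ltW u0)).
    have e1 : \int[P u]_x (cst 1 x : R) = 1 :> R by rewrite /Rintegral integral_one.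
    rewrite -[X in X - _]e1.
    rewrite -RintegralB// -RintegralZl//; last exact: integrable_subr.
    rewrite /Rintegral fineK; first exact: eq_integral.
    apply: integrable_fin_num => //.
    by apply: integrable_scaler; exact: integrable_subr.
  rewrite wE in h1.
  have h3 := le_trans h2 h1.
  have Y_fin : iter n.+1 A g1 0 \is a fin_num.
    rewrite ge0_fin_numE; last exact: iter_wshift_ge0.
    by apply: le_lt_trans (ltry 1); exact: iter_wshift_le1.
  move: h3; rewrite -/A -(fineK Y_fin) -EFinM -EFinD !lee_fin.
  have := expR_ge1Dx (- u * Phi nu eta).
  have nuPhi : n.+1%:R * (u * Phi nu eta) <= 2^-1.
    by apply: le_trans sPhi; rewrite mulrA ler_wpM2r// Phi_ge0.
  have n10 : 0 < n.+1%:R :> R by [].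
  set e := expR _; set y := fine _; set N := n.+1%:R; set q := u * Phi nu eta => he.
  have : N * (2^-1 * (1 - e)) <= N * (2^-1 * q).
    by rewrite ler_pM2l// ler_pM2l//; move: he; rewrite mulNr -/q; lra.
  rewrite -/q -/N in nuPhi; lra.
(* Apply the n+1 small increments to the one-jump inequality; the error C u^2 stays the same. *)
have main : ((u * (2^-1 * eps * I))%:E * iter n.+1 A g1 0%R <= X + (C * u ^+ 2)%:E)%E.
  have := iter_wshiftDcst (P u) mw w01 n.+1 mBf Bf0 Cu0 0; apply: le_trans.
  have /(congr1 (fun h => h 0)) /= <- := iter_wshiftZ (P u) n.+1 mv v0 mg1 g10 kappa0.
  apply: (@le_iter_wshift _ _ (P u) _ n.+1) => //.
  - by apply: emeasurable_funM => //; exact: measurable_cst.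
  - by apply: emeasurable_funD => //; exact: measurable_cst.
  - by move=> x; rewrite mule_ge0.
  - by move=> x; exact: HC (ltW u0).
have : ((u * (2^-1 * eps * I) * (1 / 2))%:E <= X + (C * u ^+ 2)%:E)%E.
  by apply: le_trans main; rewrite EFinM lee_wpmul2l.
move: XF; rewrite -(fineK X_fin) -EFinM -EFinD !lee_fin => XF.
move=> /(ler_wpM2l (ltW n20)); rewrite mulrDr => h.
have E1 : n.+2%:R * (u * (2^-1 * eps * I) * (1 / 2)) = s * (4^-1 * eps * I).
  by rewrite -su; field.
have E2 : n.+2%:R * (C * u ^+ 2) = C * s ^+ 2 / n.+2%:R.
  by rewrite /u; field; rewrite gt_eqF.
by rewrite E1 E2 in h; rewrite lerBlDr; apply: le_trans h _; rewrite lerD2r.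
Qed.

End test_function.

End jump_lower_bound.

(** * From trigonometric polynomials to densities *)

Section cosine_bump.
Context (R : realType).
Implicit Types a x : R.

(** Mean value theorem, with cos c >= 1 - c^2 >= 3/4 for 0 <= c <= 1/2. *)
Lemma sin_ge x : 0 <= x -> x <= 2^-1 -> 3 / 4 * x <= sin x.
Proof.
move=> x0 x1; have [] := @MVT_segment R sin cos 0 x x0.
  by apply/continuous_subspaceT => y; exact: continuous_sin.
move=> c; rewrite in_itv/= => /andP[c0 cx]; rewrite sin0 !subr0 => ->.
by rewrite ler_wpM2r//; have := one_sub_cos_le c; nra.
Qed.

(** This is cos(a/2L) to the power 2 K L^2. The factor L^2 in the exponent compensates the scaling
    by L: for |a| <= L the size is governed by K alone. *)
Definition bump (K L : nat) a : R := (2^-1 * (1 + cos (L%:R^-1 * a))) ^+ (K * L ^ 2).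

Let baseE (t : R) : 2^-1 * (1 + cos t) = 1 - sin (t / 2) ^+ 2.
Proof. by have := one_sub_cosE t; lra. Qed.

Lemma bump_ge0 K L a : 0 <= bump K L a.
Proof. by rewrite exprn_ge0//; have := cos_geN1 (L%:R^-1 * a); lra. Qed.

Lemma bump_le1 K L a : bump K L a <= 1.
Proof.
have := cos_geN1 (L%:R^-1 * a); have := cos_le1 (L%:R^-1 * a) => ? ?.
by rewrite /bump exprn_ile1//; lra.
Qed.

Let half_angle (L : nat) a : L%:R^-1 * a / 2 = a / (2 * L%:R).
Proof. by rewrite invfM; ring. Qed.

(** From 1 - b >= exp(-2b) for 0 <= b <= 1/2, with b = sin(a/2L)^2 <= (a/2L)^2 <= 1/4. *)
Lemma bump_ge K L a : (0 < L)%N -> `|a| <= L%:R -> expR (- (K%:R * (a ^+ 2 / 2))) <= bump K L a.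
Proof.
move=> L0 aL; have LR : 0 < L%:R :> R by rewrite ltr0n.
rewrite /bump baseE half_angle; set b := sin _ ^+ 2.
have b0 : 0 <= b by exact: sqr_ge0.
have ba : b <= (a / (2 * L%:R)) ^+ 2.
  by rewrite /b -[sin _ ^+ 2]real_normK ?num_real// -[leRHS]real_normK ?num_real//
    lerXn2r ?nnegrE// normr_sin_le.
have a1 : (a / (2 * L%:R)) ^+ 2 <= 4^-1.
  rewrite -[leLHS]real_normK ?num_real// (_ : 4^-1 = 2^-1 ^+ 2); last by field.
  rewrite lerXn2r ?nnegrE// normf_div ler_pdivrMr ?normr_gt0; last by rewrite gt_eqF// mulr_gt0.
  by rewrite (@ger0_norm _ (2 * L%:R)); lra.
have -> : - (K%:R * (a ^+ 2 / 2)) = (K * L ^ 2)%:R * (- (2 * (a / (2 * L%:R)) ^+ 2)).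
  by rewrite natrM natrX; field; rewrite gt_eqF.
rewrite expRM_natl lerXn2r ?nnegrE ?expR_ge0//; first lra.
apply: (@le_trans _ _ (expR (- (2 * b)))); first by rewrite ler_expR lerN2; lra.
rewrite expRN -[leRHS]invrK lef_pV2 ?posrE ?expR_gt0//; last by rewrite invr_gt0; lra.
apply: le_trans (expR_ge1Dx _); rewrite -[leLHS]mul1r ler_pdivrMr; last by lra.
by nra.
Qed.

(** From 1 - b <= exp(-b) and [sin_ge] at |a|/2L <= 1/2; the constant is 9/64 = (3/4)^2/4. *)
Lemma bump_le K L a : (0 < L)%N -> `|a| <= L%:R ->
  bump K L a <= expR (- (K%:R * (9 / 64 * a ^+ 2))).
Proof.
move=> L0 aL; have LR : 0 < L%:R :> R by rewrite ltr0n.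
have -> : - (K%:R * (9 / 64 * a ^+ 2)) = (K * L ^ 2)%:R * (- (3 / 4 * (a / (2 * L%:R))) ^+ 2).
  by rewrite natrM natrX; field; rewrite gt_eqF.
rewrite expRM_natl lerXn2r ?nnegrE ?expR_ge0//.
rewrite baseE half_angle; apply: le_trans (expR_ge1Dx _); rewrite lerD2l lerN2.
have E : sin (a / (2 * L%:R)) ^+ 2 = sin (`|a| / (2 * L%:R)) ^+ 2.
  by have [//|_] := ger0P a; rewrite mulNr sinN sqrrN.
rewrite E (_ : (3 / 4 * (a / (2 * L%:R))) ^+ 2 = (3 / 4 * (`|a| / (2 * L%:R))) ^+ 2).
  rewrite lerXn2r ?nnegrE ?mulr_ge0 ?invr_ge0 ?mulr_ge0//.
  - apply: le_trans (sin_ge _ _); rewrite ?mulr_ge0 ?invr_ge0 ?mulr_ge0//.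
    by rewrite ler_pdivrMr ?mulr_gt0// mulKf.
  - apply: sin_ge; rewrite ?mulr_ge0 ?invr_ge0 ?mulr_ge0//.
    by rewrite ler_pdivrMr ?mulr_gt0// mulKf.
by rewrite !exprMn real_normK ?num_real.
Qed.

End cosine_bump.
Lemma expR_unbounded (R : realType) (a b c : R) : 0 < a -> 0 < b ->
  ~ (forall K : nat, a * expR (K%:R * b) <= c).
Proof.
move=> a0 b0 H; have ab0 := mulr_gt0 a0 b0.
have := H (Num.truncn (c / (a * b))).+1; apply/negP; rewrite -ltNge.
have := truncnS_gt (c / (a * b)); rewrite ltr_pdivrMr// => h.
apply: (lt_le_trans h); rewrite mulrCA ler_pM2l//.
by apply: le_trans (expR_ge1Dx _); rewrite lerDr.
Qed.

Section density_bound.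
Context (R : realType) (d : nat).
Local Notation V := 'rV[R]_d.
Local Notation m := (lebesgue_rV R d).
Implicit Types (x y v : V).

Lemma dotp_delta (c : R) i x : dotp (c *: delta_mx 0 i) x = c * x 0 i.
Proof.
rewrite /dotp (bigD1 i)//= big1 ?addr0 => [|j ji].
  by rewrite !mxE !eqxx mulr1.
by rewrite !mxE eqxx (negbTE ji) mulr0 mul0r.
Qed.

Definition bumpV K L y x : R := \prod_i bump K L (x 0 i - y 0 i).

Lemma trig_bumpV K L y : trig (bumpV K L y).
Proof.
apply: trig_prod => i; apply: trig_exp.
apply: (@eq_trig _ _ (fun x => 2^-1 * (cst 1 x +
  cos (dotp (L%:R^-1 *: delta_mx 0 i) x + - (L%:R^-1 * y 0 i))))); last first.
  by apply: trig_scale; apply: trig_add; [exact: trig_cst|exact: trig_cos].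
by move=> x /=; rewrite dotp_delta mulrBr.
Qed.

Lemma bumpV_ge0 K L y x : 0 <= bumpV K L y x.
Proof. by apply: prodr_ge0 => i _; exact: bump_ge0. Qed.

Lemma bumpV_le_coord K L y x i : bumpV K L y x <= bump K L (x 0 i - y 0 i).
Proof.
rewrite /bumpV (bigD1 i)//= ler_piMr ?bump_ge0//.
by apply: prodr_ile1 => j _; rewrite bump_ge0 bump_le1.
Qed.

Lemma bumpV_le1 K L y x : bumpV K L y x <= 1.
Proof. by apply: prodr_ile1 => j _; rewrite bump_ge0 bump_le1. Qed.

Lemma bumpV_ge K L y x (r : R) : (0 < L)%N -> r <= L%:R ->
  (forall i, `|x 0 i - y 0 i| <= r) ->
  expR (- (K%:R * (d%:R * r ^+ 2 / 2))) <= bumpV K L y x.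
Proof.
move=> L0 rL xy.
have -> : - (K%:R * (d%:R * r ^+ 2 / 2)) = d%:R * (- (K%:R * (r ^+ 2 / 2))) by field.
rewrite expRM_natl -[d in leLHS]card_ord -prodr_const; apply: ler_prod => i _.
rewrite expR_ge0/=; apply: le_trans (bump_ge K L0 (le_trans (xy i) rL)).
rewrite ler_expR lerN2 ler_wpM2l// ler_wpM2r// -[leLHS]real_normK ?num_real//.
by rewrite lerXn2r ?nnegrE// (le_trans _ (xy i)).
Qed.

(** Bumps recur periodically, so the mass far from y can only be controlled by tightness of mu, with
    a period exceeding the scale found here. *)
Lemma hcube_exhausts (mu : probability V R) y (e : R) : 0 < e ->
  exists L0 : nat, forall L, (L0 <= L)%N -> (mu (~` hcube y L%:R) <= e%:E)%E.
Proof.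
move=> e0; have mc L := measurable_hcube y L%:R.
have cvgF : mu (hcube y n%:R) @[n --> \oo] --> mu (\bigcup_n hcube y n%:R).
  apply: nondecreasing_cvg_mu => //; first exact: bigcupT_measurable.
  move=> a b ab; apply/subsetPset => x xa i; have := xa i.
  have : a%:R <= b%:R :> R by rewrite ler_nat.
  by rewrite !in_itv/= => ? /andP[? ?]; apply/andP; split; lra.
have UT : \bigcup_n hcube y n%:R = setT.
  apply/seteqP; split => // x _.
  exists (Num.truncn (`|x - y|)).+1 => //; apply: norm_hcube => i.
  apply: le_lt_trans (truncnS_gt _); have := normr_coord_le (x - y) i.
  by rewrite !mxE.
rewrite UT probability_setT in cvgF.
have cvg1 : fine (mu (hcube y n%:R)) @[n --> \oo] --> (1 : R).
  by apply: fine_cvg; exact: cvgF.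
move/cvgrPdist_lt : cvg1 => /(_ e e0)[L0 _ HL]; exists L0 => L /HL /=.
rewrite probability_setC// -[mu (hcube y L%:R)]fineK; last first.
  exact: fin_num_measure.
rewrite -EFinB lee_fin => /ltW; apply: le_trans; exact: ler_norm.
Qed.

Section pointwise.
Variables (mu : probability V R) (p : V -> R) (v : V) (rho C : R).
Hypothesis p_density : continuous_density mu p.
Hypothesis C0 : 0 <= C.
Hypothesis test_bound : forall f : V -> R, trig f -> (forall x, 0 <= f x) ->
  (C%:E * \int[m]_(x in hcube v rho) (f x)%:E <= \int[mu]_x (f x)%:E)%E.

(* A continuous density below C near y would be detected by a bump of height
   about exp(-K a^2/4) at distance a from y and period 2 pi L: first L, then K
   tends to infinity. *)
Lemma density_ge y : `|y - v| < rho -> C <= p y.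
Proof.
move=> y_v; have [cp p0 pE] := p_density.
rewrite leNgt; apply/negP => pyC.
pose C' := (p y + C) / 2.
have pC' : p y < C' by rewrite /C'; lra.
have C'C : C' < C by rewrite /C'; lra.
have C'0 : 0 < C' by exact: le_lt_trans pC'.
have [r1 r10 Hr1] := continuous_lt_ball cp pC'.
have [r r0 Hr] : exists2 r : R, 0 < r & forall x, hcube y r x ->
    p x <= C' /\ hcube v rho x.
  pose g := (rho - `|y - v|) / 2.
  have g0 : 0 < g by rewrite divr_gt0// subr_gt0.
  have r0 : 0 < Num.min r1 g by rewrite lt_min r10.
  exists (Num.min r1 g) => // x xy; have := hcube_normr (ltW r0) xy.
  rewrite le_min => /andP[x1 x2]; split; first exact/ltW/Hr1.
  apply: norm_hcube => i; have := normr_coord_le (x - v) i; rewrite !mxE.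
  move=> /le_lt_trans; apply; apply: le_lt_trans (ler_distD y _ _) _.
  by move: x2; rewrite /g; lra.
pose D := hcube y r; have mD : measurable D by exact: measurable_hcube.
(* On the cube of radius r' the bump is at least exp(-K r^2/128), beyond radius r and within L it is
   at most exp(-18 K r^2/128). The factor d+1 absorbs the sum over the coordinates. *)
pose r' := r / (8 * d.+1%:R).
have d1 : 1 <= d.+1%:R :> R by rewrite ler1n.
have r'0 : 0 < r' by rewrite divr_gt0// mulr_gt0.
have r'r : r' <= r.
  by rewrite ler_pdivrMr ?mulr_gt0//; rewrite ler_peMr ?ltW//; lra.
have r'd : d%:R * r' ^+ 2 / 2 <= r ^+ 2 / 128.
  have -> : d%:R * r' ^+ 2 / 2 = r ^+ 2 / 128 * (d%:R / d.+1%:R ^+ 2).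
    by rewrite /r'; field; rewrite gt_eqF//; lra.
  rewrite ler_piMr ?divr_ge0 ?sqr_ge0// ler_pdivrMr ?exprn_gt0// mul1r.
  by rewrite -natr1; have := ler0n R d; nra.
(* The exponents differ by 17/128 K r^2, so this cannot hold for all K. *)
suff key K : (C - C') * (2 * r') ^+ d * expR (- (K%:R * (r ^+ 2 / 128))) <=
    2 * expR (- (K%:R * (9 / 64 * r ^+ 2))).
  pose a := (C - C') * (2 * r') ^+ d; pose b := 17 / 128 * r ^+ 2.
  have a0 : 0 < a by rewrite mulr_gt0 ?subr_gt0// exprn_gt0// mulr_gt0.
  have b0 : 0 < b by rewrite mulr_gt0// exprn_gt0.
  apply: (@expR_unbounded _ a b 2 a0 b0) => K.
  have := key K; rewrite -/a -ler_pdivlMr ?expR_gt0// => h.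
  rewrite -ler_pdivlMr ?expR_gt0//; apply: le_trans h _.
  rewrite -[leLHS]mulrA ler_pM2l// -!expRN -expRD ler_expR opprK /b; lra.
(* [E] bounds the bump between the cubes of radius r and L, and also serves as the permitted mass
   outside the latter; hence 2E below, and L depends on K. *)
pose E := expR (- (K%:R * (9 / 64 * r ^+ 2))).
have E0 : 0 < E by exact: expR_gt0.
have [L0 HL0] := hcube_exhausts mu y E0.
pose L := maxn L0 (Num.truncn r).+1.
have L_gt0 : (0 < L)%N by rewrite leq_max orbT.
have rL : r <= L%:R.
  by apply: (le_trans (ltW (truncnS_gt r))); rewrite ler_nat leq_maxr.
have muL : (mu (~` hcube y L%:R) <= E%:E)%E by apply: HL0; exact: leq_maxl.
pose T := bumpV K L y.
have tT : trig T by exact: trig_bumpV.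
have mT := measurable_trig tT.
have mTE : measurable_fun setT (fun x => (T x)%:E) by exact/measurable_EFinP.
have T0 x : (0 <= (T x)%:E)%E by rewrite lee_fin bumpV_ge0.
have mTD A : measurable_fun A (fun x => (T x)%:E) by exact: measurable_funTS.
have JD : (\int[m]_(x in D) (T x)%:E)%E \is a fin_num.
  rewrite ge0_fin_numE; last by apply: integral_ge0.
  apply: (@le_lt_trans _ _ (\int[m]_(x in D) (cst 1 x : R)%:E)%E).
    apply: ge0_le_integral => //; last by move=> x _; rewrite lee_fin bumpV_le1.
    by apply/measurable_EFinP; exact: measurable_cst.
  by rewrite /= integral_cst// mul1e; apply: lebesgue_hcube_lty; exact: ltW.
pose J := fine (\int[m]_(x in D) (T x)%:E)%E.
have JE : (\int[m]_(x in D) (T x)%:E = J%:E)%E by rewrite fineK.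
have J_ge : (2 * r') ^+ d * expR (- (K%:R * (r ^+ 2 / 128))) <= J.
  rewrite -lee_fin -JE.
  have mD' : measurable (hcube y r') by exact: measurable_hcube.
  apply: (@le_trans _ _ (\int[m]_(x in hcube y r') (T x)%:E)%E); last first.
    apply: ge0_subset_integral => // x xr' i; have := xr' i.
    by rewrite !in_itv/= => /andP[? ?]; apply/andP; split; lra.
  apply: (@le_trans _ _ (\int[m]_(x in hcube y r')
      (cst (expR (- (K%:R * (r ^+ 2 / 128)))) x : R)%:E)%E).
    rewrite /= integral_cst// [X in (_ <= _ * X)%E]lebesgue_hcube; last exact: ltW.
    by rewrite -EFinM mulrC.
  apply: ge0_le_integral => //.
  - by move=> x _; rewrite lee_fin expR_ge0.
  - by apply/measurable_EFinP; exact: measurable_cst.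
  - move=> x /hcube_norm xy; rewrite lee_fin.
    apply: le_trans (bumpV_ge K L_gt0 (le_trans r'r rL) xy).
    by rewrite ler_expR lerN2 ler_wpM2l.
have J_test : (C%:E * J%:E <= \int[mu]_x (T x)%:E)%E.
  apply: le_trans (test_bound tT _); last by move=> x; exact: bumpV_ge0.
  rewrite lee_wpmul2l ?lee_fin// -JE; apply: ge0_subset_integral => //.
    exact: measurable_hcube.
  by move=> x /Hr[].
have near_y : (\int[mu]_(x in D) (T x)%:E <= (C' * J)%:E)%E.
  (* On D the density is at most C', so there mu/C' is dominated by Lebesgue measure. *)
  have : (C'^-1%:E * \int[mu]_(x in D) (T x)%:E <= \int[m]_(x in D) (T x)%:E)%E.
    apply: (@ge0_le_dominated_integral _ _ _ mu m) => //.
      by rewrite invr_ge0 ltW.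
    move=> A mA AD; rewrite lee_pdivrMl//.
    apply: (@le_trans _ _ (\int[m]_(x in A) (cst C' x : R)%:E)%E); last first.
      by rewrite /= integral_cst.
    rewrite [leLHS]pE//; apply: ge0_le_integral => //.
    - by move=> x _; rewrite lee_fin.
    - by apply/measurable_EFinP; apply: measurable_funTS; exact: measurable_fun_continuous.
    - by apply/measurable_EFinP; exact: measurable_cst.
    - by move=> x /AD /Hr[]; rewrite lee_fin.
  by rewrite JE lee_pdivrMl// EFinM.
have far : (\int[mu]_(x in ~` D) (T x)%:E <= (2 * E)%:E)%E.
  have mDc : measurable (~` D) by exact: measurableC.
  have mLc : measurable (~` hcube y L%:R) by apply: measurableC; exact: measurable_hcube.
  pose H (x : V) : R := cst E x + \1_(~` hcube y L%:R) x.
  have H0 x : 0 <= H x by rewrite addr_ge0// ltW.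
  have mH : measurable_fun setT H.
    by apply: measurable_funD; [exact: measurable_cst|exact: measurable_indic].
  apply: (@le_trans _ _ (\int[mu]_(x in ~` D) (H x)%:E)%E).
    apply: ge0_le_integral => //.
    - by apply/measurable_EFinP; exact: measurable_funTS.
    - move=> x Dx; rewrite lee_fin /H indicE.
      have [xL|xL] := pselect (hcube y L%:R x); last first.
        by rewrite mem_set//= (le_trans (bumpV_le1 _ _ _ _))// lerDr ltW.
      rewrite memNset ?addr0/=; last by apply.
      have [i xi] : exists i, ~ (x 0 i \in `]y 0 i - r, y 0 i + r]) by exact/existsNP.
      have rx : r <= `|x 0 i - y 0 i|.
        rewrite leNgt; apply/negP => xr; apply: xi.
        by move: xr; rewrite ltr_distl in_itv/= => /andP[? ?]; apply/andP; split; lra.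
      apply: le_trans (bumpV_le_coord _ _ _ _ i) _.
      apply: le_trans (bump_le K L_gt0 (hcube_norm xL i)) _.
      rewrite ler_expR lerN2 ler_wpM2l// ler_pM2l//.
      rewrite -[leRHS]real_normK ?num_real// lerXn2r ?nnegrE//; exact: ltW.
  apply: (@le_trans _ _ (\int[mu]_x (H x)%:E)%E).
    by apply: ge0_subset_integral => //; [exact/measurable_EFinP|move=> x _; rewrite lee_fin].
  have -> : (\int[mu]_x (H x)%:E = E%:E + mu (~` hcube y L%:R))%E.
    under eq_integral do rewrite EFinD.
    rewrite ge0_integralD//; last 3 first.
    - by move=> x _; rewrite lee_fin ltW.
    - by apply/measurable_EFinP; exact: measurable_cst.
    - by apply/measurable_EFinP; exact: measurable_indic.
    rewrite /= integral_cst// [X in (_ * X)%E]probability_setT mule1.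
    by rewrite integral_indic// setIT.
  by rewrite (_ : 2 * E = E + E) ?EFinD ?leeD2l//; lra.
have : (C%:E * J%:E <= (C' * J)%:E + (2 * E)%:E)%E.
  apply: le_trans J_test _.
  rewrite -(setUv D) ge0_integral_setU ?setUv//; last first.
  - by apply/disj_setPLR; rewrite setCK.
  - exact: measurableC.
  exact: leeD.
rewrite -EFinM -EFinD lee_fin => h.
have : (C - C') * J <= 2 * E by rewrite mulrBl; lra.
apply: le_trans; rewrite -mulrA ler_wpM2l// subr_ge0 ltW//.
Qed.

End pointwise.

End density_bound.

(** * Chaining *)

Section chaining.
Context (R : realType) (d : nat) (P : R -> probability 'rV[R]_d R) (p : R -> 'rV[R]_d -> R).
Hypothesis P_conv : convolution_semigroup P.
Hypothesis p_density : forall t : R, 0 < t -> continuous_density (P t) (p t).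
Local Notation V := 'rV[R]_d.
Local Notation m := (lebesgue_rV R d).

Lemma density_measure_ge (mu : probability V R) (g : V -> R) (A : set V) (c : R) :
  continuous_density mu g -> measurable A -> 0 <= c -> (forall x, A x -> c <= g x) ->
  (c%:E * m A <= mu A)%E.
Proof.
move=> [cg g0 gE] mA c0 cA; rewrite [leRHS]gE//.
have -> : (c%:E * m A = \int[m]_(x in A) (cst c x : R)%:E)%E by rewrite /= integral_cst.
apply: ge0_le_integral => //.
- by apply/measurable_EFinP; exact: measurable_cst.
- by apply/measurable_EFinP; apply: measurable_funTS; exact: measurable_fun_continuous.
Qed.

Lemma density_measure_le (mu : probability V R) (g : V -> R) (A : set V) (c : R) :
  continuous_density mu g -> measurable A -> (forall x, A x -> g x <= c) ->
  (mu A <= c%:E * m A)%E.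
Proof.
move=> [cg g0 gE] mA cA; rewrite [leLHS]gE//.
have -> : (c%:E * m A = \int[m]_(x in A) (cst c x : R)%:E)%E by rewrite /= integral_cst.
apply: ge0_le_integral => //.
- by move=> x _; rewrite lee_fin.
- by apply/measurable_EFinP; apply: measurable_funTS; exact: measurable_fun_continuous.
- by apply/measurable_EFinP; exact: measurable_cst.
Qed.

(** The semigroup law concerns measures, not the densities pointwise. A value of p_(s+t) below the
    bound at x0 would, by continuity, make the measure of a small cube about x0 too small; the
    margin [e] provides the neighbourhood for this. The last factor is the volume of the
    intermediate cube about z0. *)
Lemma density_convolution_ge (s t : R) (x0 z0 : V) (c c' r e : R) :
  0 < s -> 0 < t -> 0 <= c -> 0 <= c' -> 0 < r -> 0 < e ->
  (forall z, `|z - z0| <= r -> c <= p s z) ->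
  (forall x z, `|x - x0| <= e -> `|z - z0| <= r -> c' <= p t (x - z)) ->
  c * c' * (2 * r) ^+ d <= p (s + t) x0.
Proof.
move=> s0 t0 c0 c'0 r0 e0 Hs Ht; rewrite leNgt; apply/negP => plt.
have st0 : 0 < s + t by exact: addr_gt0.
have [cp p0 pE] := p_density st0.
pose Q := c * c' * (2 * r) ^+ d.
pose C := (p (s + t) x0 + Q) / 2.
have pC : p (s + t) x0 < C by move: plt; rewrite /C -/Q; lra.
have CQ : C < Q by move: plt; rewrite /C -/Q; lra.
have [r1 r10 Hr1] := continuous_lt_ball cp pC.
pose q := Num.min r1 e.
have q0 : 0 < q by rewrite lt_min r10.
pose B := hcube x0 q; have mB : measurable B by exact: measurable_hcube.
pose D := hcube z0 r; have mD : measurable D by exact: measurable_hcube.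
have mBE : m B = ((2 * q) ^+ d)%:E by apply: lebesgue_hcube; exact: ltW.
have mDE : m D = ((2 * r) ^+ d)%:E by apply: lebesgue_hcube; exact: ltW.
have up : (P (s + t)%R B <= (C * (2 * q) ^+ d)%:E)%E.
  rewrite EFinM -mBE; apply: density_measure_le => //.
  move=> x /(hcube_normr (ltW q0)); rewrite le_min => /andP[x1 _]; exact/ltW/Hr1.
suff low : ((Q * (2 * q) ^+ d)%:E <= P (s + t)%R B)%E.
  have := le_trans low up; rewrite lee_fin ler_pM2r; last first.
    by rewrite exprn_gt0// mulr_gt0.
  by rewrite leNgt CQ.
have [_ PD _] := P_conv.
have -> : P (s + t)%R B = (\int[P s]_z P t [set y | B (z + y)%R])%E.
  exact: (PD s t B (ltW s0) (ltW t0) mB).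
have step z : D z -> ((c' * (2 * q) ^+ d)%:E <= P t [set y | B (z + y)%R])%E.
  move=> /(hcube_normr (ltW r0)) zr.
  have -> : [set y | B (z + y)%R] = hcube (x0 - z) q.
    have BE y := hcube_shift (x0 - z) z q y; rewrite subrKC in BE.
    by apply/seteqP; split => y /BE.
  rewrite EFinM -(lebesgue_hcube (x0 - z) (ltW q0)).
  apply: (density_measure_ge (p_density t0)) => //; first exact: measurable_hcube.
  move=> y /(hcube_normr (ltW q0)) yq.
  have -> : y = (y + z) - z by rewrite addrK.
  apply: Ht => //; apply: le_trans (_ : q <= e); last by rewrite ge_min lexx orbT.
  by move: yq; rewrite opprB addrA.
have mstep : measurable_fun setT (fun z : V => P t [set y : V | B (z + y)%R]).
  have mS : measurable ((fun u : V * V => u.1 + u.2)%R @^-1` B).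
    by rewrite -[X in measurable X]setTI; exact: measurable_addV.
  rewrite (_ : (fun z : V => _) = P t \o xsection ((fun u : V * V => u.1 + u.2)%R @^-1` B)).
    exact: measurable_fun_xsection.
  apply/funext => z /=; congr (P t _).
  by apply/seteqP; split => y /=; rewrite /xsection/= inE.
apply: (@le_trans _ _ (\int[P s]_(z in D) (cst (c' * (2 * q) ^+ d) z : R)%:E)%E); last first.
  apply: (@le_trans _ _ (\int[P s]_(z in D) P t [set y | B (z + y)%R])%E).
    apply: ge0_le_integral => //.
    - by move=> z _; rewrite lee_fin mulr_ge0// exprn_ge0// mulr_ge0// ltW.
    - by apply/measurable_EFinP; exact: measurable_cst.
    - exact: measurable_funTS.
  exact: ge0_subset_integral.
rewrite /= integral_cst//.
have : (c%:E * m D <= P s D)%E.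
  apply: (density_measure_ge (p_density s0)) => //.
  by move=> z /(hcube_normr (ltW r0)); exact: Hs.
rewrite mDE -EFinM => h.
apply: le_trans (lee_wpmul2l _ h).
  rewrite -EFinM lee_fin /Q le_eqVlt; apply/orP; left; apply/eqP; ring.
by rewrite lee_fin mulr_ge0// exprn_ge0// mulr_ge0// ltW.
Qed.

(** One step reaches 2r. Since the intermediate point must range over a cube of radius r/2 to gain
    the volume r^d, each further step extends the reach by r. *)
Lemma density_chain (tau a r : R) : 0 < tau -> 0 <= a -> 0 < r ->
  (forall x, `|x| < 2 * r -> a <= p tau x) ->
  forall k x, `|x| < k.+2%:R * r -> a * (a * r ^+ d) ^+ k <= p (k.+1%:R * tau) x.
Proof.
move=> tau0 a0 r0 Ha; elim=> [|k IH] x xk; first by rewrite expr0 mulr1 mul1r; exact: Ha.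
have k3 : 0 < k.+3%:R :> R by [].
(* The intermediate point is lam x. Then lam |x| < 3r/2 leaves r/2 for its variation, and the rest
   of the way falls short of (k+2) r by more than r/2; [e] is half of that surplus. *)
pose lam : R := 3 / 2 / k.+3%:R.
have lamk : lam * k.+3%:R = 3 / 2 by rewrite divfK// gt_eqF.
have lam0 : 0 < lam by rewrite divr_gt0.
have lam1 : lam <= 1 / 2.
  rewrite ler_pdivrMr//; apply: (@le_trans _ _ (1 / 2 * 3)); first by lra.
  by rewrite ler_pM2l// ler_nat.
clearbody lam.
have k3E : k.+3%:R = k.+2%:R + 1 :> R by rewrite natr1.
have xk1 : lam * `|x| < 3 / 2 * r by rewrite -lamk -mulrA ltr_pM2l.
have xk2 : (1 - lam) * `|x| < k.+2%:R * r - r / 2.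
  have -> : k.+2%:R * r - r / 2 = (1 - lam) * (k.+3%:R * r).
    by rewrite mulrA mulrBl mul1r lamk k3E; field.
  by rewrite ltr_pM2l//; lra.
pose e := (k.+2%:R * r - r / 2 - (1 - lam) * `|x|) / 2.
have e0 : 0 < e by rewrite divr_gt0// subr_gt0.
have -> : k.+2%:R * tau = tau + k.+1%:R * tau by rewrite -(natr1 k.+1); ring.
have -> : a * (a * r ^+ d) ^+ k.+1 = a * (a * (a * r ^+ d) ^+ k) * (2 * (r / 2)) ^+ d.
  by rewrite (_ : 2 * (r / 2) = r) ?exprS; [ring|field].
apply: (@density_convolution_ge tau (k.+1%:R * tau) x (lam *: x) _ _ (r / 2) e) => //.
- exact: mulr_gt0.
- by rewrite mulr_ge0// exprn_ge0// mulr_ge0// exprn_ge0// ltW.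
- by rewrite divr_gt0.
- move=> z zr; apply: Ha; rewrite -[z](subrK (lam *: x)).
  apply: le_lt_trans (ler_normD _ _) _; rewrite normrZ gtr0_norm//; lra.
- move=> y z yx zx; apply: IH.
  have -> : y - z = (y - x) + (1 - lam) *: x - (z - lam *: x).
    by apply/rowP => i; rewrite !mxE; ring.
  apply: le_lt_trans (ler_normB _ _) _.
  have := ler_normD (y - x) ((1 - lam) *: x).
  rewrite normrZ (@ger0_norm _ (1 - lam)); last by lra.
  have eE : 2 * e = k.+2%:R * r - r / 2 - (1 - lam) * `|x| by rewrite /e; field.
  move: eE yx zx e0; clearbody e; move: (k.+2%:R * r) ((1 - lam) * `|x|) => A B.
  move: (`|y - x|) (`|z - _|) (`|_ + _|) => *; lra.
Qed.

End chaining.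

Section log_bound.
Context (R : realType) (d : nat) (P : R -> probability 'rV[R]_d R) (p : R -> 'rV[R]_d -> R).
Hypothesis P_conv : convolution_semigroup P.
Hypothesis p_density : forall t : R, 0 < t -> continuous_density (P t) (p t).
Local Notation V := 'rV[R]_d.

(** Go to a point near v and return by a jump near -v. The position x, its perturbation and the
    intermediate point cost rho/4 each, less than rho together. *)
Lemma density_two_jumps (v : V) (rho s a : R) : 0 < rho -> 0 < s -> 0 <= a ->
  (forall y, `|y - v| < rho -> a <= p s y) -> (forall y, `|y + v| < rho -> a <= p s y) ->
  forall x, `|x| < rho / 4 -> a * a * (rho / 2) ^+ d <= p (2 * s) x.
Proof.
move=> rho0 s0 a0 Hv HNv x xrho.
rewrite (_ : rho / 2 = 2 * (rho / 4)); last by field.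
rewrite (_ : 2 * s = s + s); last by ring.
have rho4 : 0 < rho / 4 by rewrite divr_gt0.
apply: (@density_convolution_ge _ _ _ _ P_conv p_density s s x v _ _ (rho / 4) (rho / 4)) => //.
  by move=> z zv; apply: Hv; lra.
move=> y z yx zv; apply: HNv.
have -> : y - z + v = (y - x) + x - (z - v) by apply/rowP => i; rewrite !mxE; ring.
apply: le_lt_trans (ler_normB _ _) _.
by have := ler_normD (y - x) x; lra.
Qed.

Lemma log_lower_bound (r s0 A0 r0 : R) : 0 < r -> 0 < s0 -> 0 < A0 -> 0 < r0 ->
  (forall s, 0 < s -> s <= s0 -> forall x, `|x| < 2 * r -> A0 * s ^+ 2 <= p (2 * s) x) ->
  exists c1 c2 c3 c4 : R, [/\ 0 < c1, 0 < c2, 0 < c3 & 0 < c4] /\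
    forall (t : R) (x : V), 0 < t -> Num.max r0 (c4 * t) <= enorm x ->
      c1 * expR (- c2 * enorm x * ln (c3 * enorm x / t)) <= p t x.
Proof.
move=> r_gt0 s0_gt0 A0_gt0 r0_gt0 H.
(* A tau^2 is the factor contributed by one step of duration tau; the 4 comes from (tau/2)^2. *)
pose A := A0 * r ^+ d / 4.
have A_gt0 : 0 < A by rewrite divr_gt0// mulr_gt0// exprn_gt0.
(* Chosen so that the number of steps N = floor(X/r) + 1 is at most B X; the second summand absorbs
   the 1 because X >= r0. *)
pose B := r^-1 + r0^-1.
have B_gt0 : 0 < B by rewrite addr_gt0// invr_gt0.
(* chosen so that A * (c3 / B)^2 >= 1 *)
pose c3 := B * (1 + A^-1).
have c3_gt0 : 0 < c3 by rewrite mulr_gt0// addr_gt0// invr_gt0.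
(* The first summand makes the argument of the logarithm at least 1, the second keeps tau/2 below
   s0. *)
pose c4 := c3^-1 + r / (2 * s0).
have c4_gt0 : 0 < c4 by rewrite addr_gt0 ?invr_gt0// divr_gt0// mulr_gt0.
exists (r ^- d), (2 * B), c3, c4; split.
  by split => //; rewrite ?invr_gt0 ?exprn_gt0// mulr_gt0.
move=> t x t_gt0; rewrite ge_max => /andP[xr0 xc4].
set X := enorm x in xr0 xc4 *.
have X_gt0 : 0 < X by exact: lt_le_trans xr0.
pose k := Num.truncn (X / r); pose N : R := k.+1%:R.
have N_gt0 : 0 < N by [].
have XN : X < N * r by rewrite -ltr_pdivrMr//; exact: truncnS_gt.
have NX : N <= B * X.
  have : k%:R <= X / r by rewrite truncn_le// divr_ge0// ltW.
  rewrite /N -natr1 /B mulrDl (mulrC _ X) => ?; rewrite lerD// ler_pdivlMl//.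
  by rewrite mulr1.
pose tau := t / N; have tau_gt0 : 0 < tau by rewrite divr_gt0.
have tau_s0 : tau / 2 <= s0.
  rewrite ler_pdivrMr// /tau ler_pdivrMr//.
  have h1 : r / (2 * s0) * t <= N * r.
    apply: le_trans (ltW XN); apply: le_trans xc4; rewrite ler_pM2r// lerDr.
    by rewrite invr_ge0 ltW.
  move: h1; rewrite mulrAC ler_pdivrMr ?mulr_gt0// (mulrC r) mulrAC ler_pM2r//.
  by rewrite (mulrC N) (mulrC 2).
have tN : N * tau = t by rewrite /tau mulrC divfK// gt_eqF.
pose a := A0 * (tau / 2) ^+ 2.
have a_gt0 : 0 < a by rewrite mulr_gt0// exprn_gt0// divr_gt0.
have step y : `|y| < 2 * r -> a <= p tau y.
  move=> yr; have -> : tau = 2 * (tau / 2) by field.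
  by apply: H => //; rewrite divr_gt0.
have xX : `|x| <= X by apply: normr_le_coord => [|i]; [exact: ltW|exact: normr_coord_le_enorm].
have := density_chain P_conv p_density tau_gt0 (ltW a_gt0) r_gt0 step (k := k) (x := x).
rewrite -/N tN => /(_ _)/wrap[].
  apply: le_lt_trans xX _; apply: lt_trans XN _; rewrite ltr_pM2r// /N ltr_nat//.
apply: le_trans.
(* k+1 steps carry only k volume factors; the missing one becomes c1 = r^-d. *)
have -> : a * (a * r ^+ d) ^+ k = r ^- d * (A * tau ^+ 2) ^+ k.+1.
  have -> : A * tau ^+ 2 = a * r ^+ d by rewrite /A /a; field.
  have cancel (u w Z : R) : 0 < w -> u * Z = w^-1 * ((u * w) * Z).
    by move=> w0; field; rewrite gt_eqF.
  by rewrite exprS; apply: cancel; rewrite exprn_gt0.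
rewrite ler_pM2l ?invr_gt0 ?exprn_gt0//.
pose q := c3 * X / t.
have q_gt0 : 0 < q by rewrite divr_gt0// mulr_gt0.
have q1 : 1 <= q.
  rewrite ler_pdivlMr// mul1r; apply: (@le_trans _ _ (c3 * (c4 * t))); last by rewrite ler_pM2l.
  rewrite mulrA ler_peMl//; first exact: ltW.
  rewrite /c4 mulrDr divff ?gt_eqF// lerDl mulr_ge0//; first exact: ltW.
  by rewrite divr_ge0 ?mulr_ge0//; exact: ltW.
have lnq : 0 <= ln q by exact: ln_ge0.
apply: (@le_trans _ _ (expR (- ln q) ^+ 2 ^+ k.+1)).
  rewrite -exprM -expRM_natl ler_expR -/q natrM -/N.
  have := ler_wpM2r lnq NX; rewrite !mulNr mulrN lerN2 -!mulrA.
  by move: (N * ln q) (B * (X * ln q)) => ? ? ?; rewrite ler_pM2l.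
rewrite lerXn2r ?nnegrE ?exprn_ge0 ?expR_ge0//.
  by rewrite mulr_ge0 ?sqr_ge0//; exact: ltW.
rewrite expRN lnK// exprVn -[leLHS]mul1r ler_pdivrMr ?exprn_gt0// -mulrA -exprMn.
have Ainv : 0 < A^-1 by rewrite invr_gt0.
(* The time t cancels in tau q, and N <= B X. Hence A tau^2 >= q^-2, so each step costs at most
   q^-2; with N <= B X this yields c2 = 2B. *)
have tq : 1 + A^-1 <= tau * q.
  have -> : tau * q = (1 + A^-1) * (B * X / N).
    by rewrite /tau /q /c3; field; rewrite !gt_eqF.
  rewrite ler_peMr//; first by lra.
  by rewrite ler_pdivlMr// mul1r.
have AA : A * A^-1 = 1 by rewrite divff// gt_eqF.
clearbody A; apply: (@le_trans _ _ (A * (1 + A^-1) ^+ 2)); first by nra.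
rewrite ler_pM2l// lerXn2r ?nnegrE//; first by lra.
by rewrite mulr_ge0//; exact: ltW.
Qed.

End log_bound.

(** * Lebesgue lower bound for nu near the origin, and choice of the constants *)

Section domination.
Context (R : realType) (d : nat).
Local Notation V := 'rV[R]_d.
Local Notation m := (lebesgue_rV R d).

(** The infimum of the Radon-Nikodym derivative may be +oo, so a real lower bound has to be
    extracted. *)
Lemma ereal_pos_real (x : \bar R) : (0 < x)%E -> exists2 e : R, 0 < e & (e%:E <= x)%E.
Proof.
case: x => [r||]//; first by rewrite lte_fin => r0; exists r.
by move=> _; exists 1 => //; rewrite leey.
Qed.

Lemma levy_ge_lebesgue (nu nu_s nu_c : {measure set V -> \bar R}) (f : V -> \bar R)
    (eps : R) (A : set V) :
  lebesgue_decomposition nu nu_s nu_c -> radon_nikodym_derivative nu_c f -> 0 <= eps ->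
  measurable A -> (forall x, A x -> (eps%:E <= f x)%E) -> (eps%:E * m A <= nu A)%E.
Proof.
move=> [nuE _ _] [mf f0 nucE] eps0 mA Af; rewrite nuE//.
apply: (@le_trans _ _ (nu_c A)); last by rewrite leeDr.
have -> : (eps%:E * m A = \int[m]_(x in A) (cst eps x : R)%:E)%E by rewrite /= integral_cst.
rewrite nucE//; apply: ge0_le_integral => //.
- by apply/measurable_EFinP; exact: measurable_cst.
- exact: measurable_funTS.
Qed.

End domination.

Lemma cos_le0_near_pi (R : realType) (a : R) : `|a - pi| <= pi / 2 -> cos a <= 0.
Proof.
rewrite ler_norml => h; rewrite -(subrK pi a) cosDpi oppr_le0.
exact: cos_ge0_pihalf.
Qed.

Theorem theorem1p2 (R : realType) (d : nat) (d_gt0 : (0 < d)%N)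
  (nu : {measure set 'rV[R]_d -> \bar R})
  (nu_levy : symmetric_levy_measure nu)
  (nuT : nu setT = +oo%E)
  (P : R -> probability 'rV[R]_d R)
  (P_nu : levy_semigroup nu P)
  (M0 : R) (M0_gt0 : 0 < M0)
  (tp : \bar R) (tp_gt0 : (0 < tp)%E)
  (integral_bound : forall t : R, 0 < t -> (t%:E < tp)%E ->
    (\int[lebesgue_rV R d]_xi (expR (- t * Phi nu xi) * enorm xi)%:E
      <= (M0 * h nu t ^- d.+1)%:E)%E)
  (p : R -> 'rV[R]_d -> R)
  (p_density : forall t : R, 0 < t -> continuous_density (P t) (p t))
  (nu_s nu_c : {measure set 'rV[R]_d -> \bar R})
  (nu_sc : lebesgue_decomposition nu nu_s nu_c)
  (f : 'rV[R]_d -> \bar R)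
  (f_nu_c : radon_nikodym_derivative nu_c f)
  (r0 : R) (r0_gt0 : 0 < r0)
  (f_inf : (0 < ereal_inf [set f y | y in [set y | (0 < enorm y < r0)%R]])%E) :
  exists c1 c2 c3 c4 : R,
    [/\ 0 < c1, 0 < c2, 0 < c3 & 0 < c4] /\
    forall (t : R) (x : 'rV[R]_d), 0 < t -> (t%:E < tp)%E ->
      Num.max r0 (c4 * t) <= enorm x ->
      p t x >= c1 * expR (- c2 * enorm x * ln (c3 * enorm x / t)).
Proof.
have [P_conv _] := P_nu.
have [eps eps0 eps_inf] := ereal_pos_real f_inf.
pose i0 : 'I_d := Ordinal d_gt0.
have d1 : 1 <= d%:R :> R by rewrite ler1n.
(* Small enough that coordinates bounded by 3b/2 force |x|^2 <= 9 r0^2/(16 d) < r0^2. *)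
pose b := r0 / (2 * d%:R).
have b0 : 0 < b by rewrite divr_gt0// mulr_gt0//; lra.
have bE : r0 = b * (2 * d%:R) by rewrite divfK// mulf_neq0// gt_eqF//; lra.
clearbody b.
pose v : 'rV[R]_d := b *: delta_mx 0 i0.
(* eta.v = pi, where the cosine is -1. Moving the coordinate by at most 2 rho = b/2 changes the
   angle by at most pi/2, so the cosine stays nonpositive. *)
pose eta : 'rV[R]_d := (pi / b) *: delta_mx 0 i0.
pose rho := b / 4; have rho0 : 0 < rho by rewrite divr_gt0.
have vE i : v 0 i = if i == i0 then b else 0.
  by rewrite !mxE eqxx /=; case: (i == i0); rewrite ?mulr1 ?mulr0.
have vNE i : (- v) 0 i = if i == i0 then - b else 0.
  by rewrite mxE vE; case: ifP; rewrite ?oppr0.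
clearbody v.
have near_v x : hcube v (2 * rho) x \/ hcube (- v) (2 * rho) x ->
    (0 < enorm x < r0) /\ cos (dotp eta x) <= 0.
  (* Both cubes are handled through |x_i0|, because the cosine is even. *)
  move=> xv; have xi0 : `|(`|x 0 i0| - b)| <= b / 2.
    case: xv => /hcube_norm/(_ i0); rewrite ?vNE ?vE eqxx => h.
      have := ler_dist_dist (x 0 i0) b; rewrite (@ger0_norm _ b) ?(ltW b0)//.
      by move/le_trans; apply; apply: le_trans h _; rewrite /rho; lra.
    have := ler_dist_dist (x 0 i0) (- b); rewrite normrN (@ger0_norm _ b) ?(ltW b0)//.
    by move/le_trans; apply; apply: le_trans h _; rewrite /rho; lra.
  have xi i : `|x 0 i| <= 3 / 2 * b.
    have [->|ii0] := eqVneq i i0.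
      by move: xi0; rewrite ler_distl => /andP[_]; lra.
    case: xv => /hcube_norm/(_ i); rewrite ?vNE ?vE (negbTE ii0) subr0;
      by move/le_trans; apply; rewrite /rho; lra.
  split; last first.
    have -> : cos (dotp eta x) = cos (pi / b * `|x 0 i0|).
      by rewrite dotp_delta; have [//|_] := ger0P (x 0 i0); rewrite mulrN cosN.
    apply: cos_le0_near_pi.
    have -> : pi / b * `|x 0 i0| - pi = pi / b * (`|x 0 i0| - b).
      by field; rewrite gt_eqF.
    rewrite normrM gtr0_norm ?divr_gt0 ?pi_gt0//.
    rewrite (_ : pi / 2 = pi / b * (b / 2)); last by field; rewrite gt_eqF.
    by rewrite ler_pM2l// divr_gt0// pi_gt0.
  apply/andP; split.
    apply: lt_le_trans (normr_coord_le_enorm x i0).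
    by move: xi0; rewrite ler_distl => /andP[+ _]; lra.
  rewrite -(ltr_pXn2r (n := 2)) ?nnegrE ?enorm_ge0//; last exact: ltW.
  apply: le_lt_trans (enorm_le_coord _ xi) _; first by lra.
  have -> : d%:R * (3 / 2 * b) ^+ 2 = r0 ^+ 2 * (9 / 16 / d%:R).
    by rewrite bE; field; rewrite gt_eqF//; lra.
  rewrite gtr_pMr ?exprn_gt0// ltr_pdivrMr; lra.
have nu_lower A : measurable A -> (forall x, A x -> 0 < enorm x < r0) ->
    (eps%:E * lebesgue_rV R d A <= nu A)%E.
  move=> mA Ar; apply: (levy_ge_lebesgue nu_sc f_nu_c (ltW eps0) mA) => x /Ar xr.
  by apply: le_trans eps_inf _; apply: ereal_inf_lbound; exists x.
have [s1 s10 Hs1] := semigroup_concentrates P_conv rho0.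
(* Ensures s Phi(eta) <= 1/2; the added 1 keeps the denominator positive. *)
pose s0 := Num.min s1 (2^-1 / (1 + Phi nu eta)).
have Phi1 : 0 < 1 + Phi nu eta by have := Phi_ge0 nu eta; lra.
have s0_gt0 : 0 < s0 by rewrite lt_min s10 divr_gt0.
have density_near (z : 'rV[R]_d) s : (forall x, hcube z (2 * rho) x ->
      (0 < enorm x < r0) /\ cos (dotp eta x) <= 0) ->
    0 < s -> s <= s0 -> forall y, `|y - z| < rho -> 4^-1 * eps * s <= p s y.
  move=> Hz s_gt0; rewrite le_min => /andP[ss1 sPhi] y yz.
  have C0 : 0 <= 4^-1 * eps * s by rewrite !mulr_ge0//; exact: ltW.
  apply: (@density_ge _ _ (P s) (p s) z rho _ (p_density s s_gt0) C0 _ y yz) => g tg g0.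
  apply: (small_time_test_bound nu_levy P_nu rho0 eps0 _ _ tg g0 Hs1 s_gt0 ss1).
  - by move=> x /Hz[_]; lra.
  - by move=> A mA AD; apply: nu_lower => // x /AD /Hz[].
  - move: sPhi; rewrite ler_pdivlMr//; have := Phi_ge0 nu eta; lra.
pose A0 := (4^-1 * eps) ^+ 2 * (rho / 2) ^+ d.
have A0_gt0 : 0 < A0 by rewrite mulr_gt0 ?exprn_gt0 ?mulr_gt0 ?divr_gt0.
(* Chaining with r = rho/8 needs the bound on the ball of radius 2r = rho/4, which is what two jumps
   give. *)
have rho8 : 0 < rho / 8 by rewrite divr_gt0.
have [|c1 [c2 [c3 [c4 [c_gt0 H]]]]] := log_lower_bound P_conv p_density rho8 s0_gt0 A0_gt0 r0_gt0.
  move=> s s_gt0 ss0 x xr.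
  have -> : A0 * s ^+ 2 = 4^-1 * eps * s * (4^-1 * eps * s) * (rho / 2) ^+ d by rewrite /A0; ring.
  apply: (density_two_jumps P_conv p_density (v := v) rho0 s_gt0).
  - by rewrite !mulr_ge0//; exact: ltW.
  - by apply: density_near => // y yv; apply: near_v; left.
  - move=> y yv; apply: (density_near (- v)) => //; last by rewrite opprK.
    by move=> z zv; apply: near_v; right.
  - by move: xr; lra.
by exists c1, c2, c3, c4; split => // t x t_gt0 _; exact: H.
Qed.
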